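(* Let $s\in\mathbb{C}$ with $\Re(s)>-\frac12$. Then the Hua-Pickrell measures are consistent with the links: for all $N\ge1$, $$\mu^{s,N+1}_{HP}\Lambda_N^{N+1}=\mu^{s,N}_{HP}.$$
   Context: $W^N=\{x\in\mathbb{R}^N:x_1\le\cdots\le x_N\}$; $\Delta_N(x)=\prod_{1\le i<j\le N}(x_j-x_i)$. $\mu^{s,N}_{HP}$ is the probability measure on $W^N$ given by $\mu^{s,N}_{HP}(dx)=\mathrm{const}\cdot\Delta_N^2(x)\prod_{j=1}^N(1+x_j^2)^{-\Re(s)-N}e^{2\Im(s)\mathrm{Arg}(1+ix_j)}dx_j$, normalized to mass $1$. For $x$ in the interior of $W^{N+1}$, $\Lambda_N^{N+1}(x,dy)=\frac{N!\,\Delta_N(y)}{\Delta_{N+1}(x)}\mathbf 1(x_1\le y_1\le x_2\le\cdots\le y_N\le x_{N+1})\,dy$; for general $x\in W^{N+1}$, $\Lambda_N^{N+1}(x,\cdot)$ is the law of the ordered eigenvalues of the top-left $N\times N$ corner of $U^*\mathrm{diag}(x_1,\dots,x_{N+1})U$, $U$ Haar distributed on $\mathbb{U}(N+1)$. *)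

(* Defs.v *)
From HB Require Import structures.
From mathcomp Require Import all_boot all_order all_algebra.
From mathcomp Require Import spectral.
From mathcomp Require Import all_classical all_reals all_analysis.
From mathcomp Require Import measurable_realfun complex.

Set Implicit Arguments.
Unset Strict Implicit.
Unset Printing Implicit Defensive.

Import Order.TTheory GRing.Theory Num.Theory.
Import numFieldTopology.Exports numFieldNormedType.Exports.

Local Open Scope classical_set_scope.
Local Open Scope ring_scope.
Local Open Scope complex_scope.
Local Open Scope sesquilinear_scope.

Section lebesgue_tuple.
Context {R : realType}.

Definition cons_pair n (p : R * n.-tuple R) : n.+1.-tuple R :=
  [tuple of p.1 :: p.2].

Lemma measurable_cons_pair n :
  measurable_fun [set: R * n.-tuple R] (@cons_pair n).
Proof. exact: (measurable_cons measurable_fst measurable_snd). Qed.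

Section step.
Variables (n : nat) (m : {sigma_finite_measure set (n.-tuple R) -> \bar R}).

Definition cons_measure : set (n.+1.-tuple R) -> \bar R :=
  pushforward (@lebesgue_measure R \x m)%E (@cons_pair n).

Let mpre (A : set (n.+1.-tuple R)) :
  measurable A -> measurable (@cons_pair n @^-1` A).
Proof. by move=> mA; rewrite -[X in measurable X]setTI; exact: measurable_cons_pair. Qed.

Let cons_measure0 : cons_measure set0 = 0%E.
Proof. by rewrite /cons_measure /pushforward preimage_set0 measure0. Qed.

Let cons_measure_ge0 A : (0 <= cons_measure A)%E.
Proof. by rewrite /cons_measure /pushforward; apply: measure_ge0. Qed.

Let cons_measure_sigma_additive : semi_sigma_additive cons_measure.
Proof.
move=> F mF tF mUF; rewrite /cons_measure /pushforward preimage_bigcup.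
apply: measure_semi_sigma_additive.
- by move=> k; exact: mpre.
- apply/trivIsetP => i j _ _ ij; rewrite -preimage_setI.
  by move/trivIsetP : tF => /(_ _ _ Logic.I Logic.I ij) ->; rewrite preimage_set0.
- by rewrite -preimage_bigcup; exact: mpre.
Qed.

HB.instance Definition _ := isMeasure.Build _ _ _ cons_measure
  cons_measure0 cons_measure_ge0 cons_measure_sigma_additive.

Let cons_measure_sigma_finite : sigma_finite setT cons_measure.
Proof.
have [F TF mF] : sigma_finite setT (@lebesgue_measure R \x m)%E.
  have /sigma_finiteP[F [TF ndF Foo]] := sigma_finiteT (@lebesgue_measure R).
  have /sigma_finiteP[G [TG ndG Goo]] := sigma_finiteT m.
  exists (fun k => F k `*` G k).
    rewrite -setXTT TF TG; apply/seteqP; split=> -[x y] /=.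
      move=> [[i _ Fx] [k _ Gy]]; exists (maxn i k) => //; split.
      - by move: x Fx; exact/subsetPset/ndF/leq_maxl.
      - by move: y Gy; exact/subsetPset/ndG/leq_maxr.
    by move=> [k _ [Fx Gy]]; split; exists k.
  move=> k; have [mFk Fkoo] := Foo k; have [mGk Gkoo] := Goo k.
  split; first exact: measurableX.
  by rewrite product_measure1E// lte_mul_pinfty// ge0_fin_numE.
pose g (x : n.+1.-tuple R) : R * n.-tuple R := (thead x, [tuple of behead x]).
have gK p : g (@cons_pair n p) = p.
  by case: p => a y; rewrite /g /=; congr pair => //; apply/val_inj.
have mg : measurable_fun setT g.
  apply: measurable_fun_pair; first exact: measurable_tnth.
  exact: measurable_behead.
exists (fun k => g @^-1` F k).
  by rewrite -preimage_bigcup -TF preimage_setT.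
move=> k; have [mFk Fkoo] := mF k; split.
  by rewrite -[X in measurable X]setTI; exact: mg.
rewrite /cons_measure /pushforward.
by rewrite (_ : _ @^-1` _ = F k)//; apply/seteqP; split=> p /=; rewrite gK.
Qed.

HB.instance Definition _ := Measure_isSigmaFinite.Build _ _ _ cons_measure
  cons_measure_sigma_finite.
End step.

(* Lebesgue measure on [R^n]; [R^0] is a point of mass 1. *)
Fixpoint lebesgue_tuple n : {sigma_finite_measure set (n.-tuple R) -> \bar R} :=
  if n is n'.+1 then cons_measure (lebesgue_tuple n')
  else \d_([tuple] : 0.-tuple R).

End lebesgue_tuple.

Section weyl_chamber.
Context {R : realType}.
Implicit Types n : nat.

Definition weyl n : set (n.-tuple R) := [set x | sorted <=%R x].

(* Tuples carry no topology in the library, so the interior of [W^n] is taken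
   in the normed space ['rV[R]_n] and transported back. *)
Definition tuple_of_rV n (v : 'rV[R]_n) : n.-tuple R :=
  [tuple v ord0 i | i < n].

Definition weyl_interior n : set (n.-tuple R) :=
  @tuple_of_rV n @` interior (@tuple_of_rV n @^-1` @weyl n).

Definition vandermonde n (x : n.-tuple R) : R :=
  \prod_(i < n) \prod_(j < n | (i < j)%N) (tnth x j - tnth x i).

Definition interlace n (x : n.+1.-tuple R) (y : n.-tuple R) : Prop :=
  forall i : 'I_n, x`_i <= y`_i <= x`_i.+1.

End weyl_chamber.
Arguments weyl {R} n _.
Arguments weyl_interior {R} n _.

Section hua_pickrell.
Context {R : realType}.

(* Principal argument, in ]-pi, pi]; [Arg 0 = pi / 2] is a junk value. *)
Definition Arg (z : R[i]) : R :=
  if 0 <= complex.Im z then acos (complex.Re z / ComplexField.Normc.normc z)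
  else - acos (complex.Re z / ComplexField.Normc.normc z).

Definition hp_factor (s : R[i]) (n : nat) (t : R) : R :=
  (1 + t ^+ 2) `^ (- complex.Re s - n%:R) *
  expR (2 * complex.Im s * Arg (1 + 'i * t%:C)).

Definition hp_weight (s : R[i]) n (x : n.-tuple R) : R :=
  vandermonde x ^+ 2 * \prod_(j < n) hp_factor s n (tnth x j).

Lemma hp_weight_ge0 s n (x : n.-tuple R) : 0 <= hp_weight s x.
Proof.
apply: mulr_ge0; first exact: sqr_ge0.
by apply: prodr_ge0 => j _; rewrite mulr_ge0 ?powR_ge0 ?expR_ge0.
Qed.

Lemma Arg_1Di (t : R) : Arg (1 + 'i * t%:C) = atan t.
Proof.
have zE : 1 + 'i * t%:C = 1 +i* t by simpc.
have pE (u : R) : 0 <= u -> acos (Num.sqrt (1 + u ^+ 2))^-1 = atan u.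
  move=> u0; rewrite -cos_atan cosK// in_itv/=; apply/andP; split.
    by rewrite -atan0 le_atan.
  by rewrite ltW// (lt_trans (atan_ltpi2 u))// ltr_pdivrMr// ltr_pMr ?pi_gt0// ltr1n.
rewrite zE /Arg /= expr1n div1r; case: ifPn => [/pE//|].
rewrite -ltNge => /ltW t0.
by rewrite -(sqrrN t) pE ?oppr_ge0// atanN opprK.
Qed.

Lemma measurable_weyl n : measurable (@weyl R n).
Proof.
have -> : weyl n = \bigcap_(i in [set: 'I_n]) \bigcap_(j in [set j : 'I_n | (i <= j)%N])
    [set x : n.-tuple R | tnth x i <= tnth x j].
  apply/seteqP; split=> [x /= sx i _ j /= ij|x /= xP].
    by rewrite !(tnth_nth 0) (sorted_leq_nth le_trans lexx)// inE size_tuple.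
  apply/(sortedP 0) => i; rewrite size_tuple => i1n.
  have i0n : (i < n)%N by exact: ltn_trans i1n.
  have := xP (Ordinal i0n) Logic.I (Ordinal i1n) (leqnSn i).
  by rewrite /= !(tnth_nth 0).
apply: fin_bigcap_measurable => // i _.
apply: fin_bigcap_measurable => // j _.
rewrite -[X in measurable X]setTI; apply: measurable_fun_le => //.
- exact: measurable_tnth.
- exact: measurable_tnth.
Qed.

Lemma measurable_hp_weight s n :
  measurable_fun [set: n.-tuple R] (@hp_weight s n).
Proof.
have mt i : measurable_fun [set: n.-tuple R] (fun x => tnth x i).
  exact: measurable_tnth.
apply: measurable_funM.
  apply: measurable_funX; apply: measurable_prod => i _.
  have -> : (fun x : n.-tuple R => \prod_(j < n | (i < j)%N) (tnth x j - tnth x i)) =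
      (fun x => \prod_(j < n) if (i < j)%N then tnth x j - tnth x i else 1).
    by apply/funext => x; exact: big_mkcond.
  apply: measurable_prod => j _ /=; case: (i < j)%N; last exact: measurable_cst.
  exact: measurable_funB.
apply: measurable_prod => i _.
have -> : (fun x : n.-tuple R => hp_factor s n (tnth x i)) =
    (fun t => (1 + t ^+ 2) `^ (- complex.Re s - n%:R) *
       expR (2 * complex.Im s * atan t)) \o (fun x => tnth x i).
  by apply/funext => x; rewrite /= /hp_factor Arg_1Di.
apply: measurableT_comp => //; apply: measurable_funM.
  apply: (measurableT_comp (measurable_powR _)).
  by apply: measurable_funD => //; exact: measurable_funX.
apply: (@measurableT_comp _ _ _ _ _ _ expR) => //; apply: measurable_funM => //.
by apply: continuous_measurable_fun => t; exact: continuous_atan.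
Qed.

Section measures.
Variables (s : R[i]) (n : nat).

Definition hp_unnormalized (A : set (n.-tuple R)) : \bar R :=
  (\int[lebesgue_tuple n]_(x in A `&` weyl n) (hp_weight s x)%:E)%E.

Let hp0 : hp_unnormalized set0 = 0%E.
Proof. by rewrite /hp_unnormalized set0I integral_set0. Qed.

Let hp_ge0 A : (0 <= hp_unnormalized A)%E.
Proof. by apply: integral_ge0 => x _; rewrite lee_fin hp_weight_ge0. Qed.

Let hp_sigma_additive : semi_sigma_additive hp_unnormalized.
Proof.
move=> F mF tF mUF; rewrite /hp_unnormalized setI_bigcupl ge0_integral_bigcup//=.
- apply: is_cvg_ereal_nneg_natsum_cond => k _ _; exact: hp_ge0.
- by move=> k; apply: measurableI => //; exact: measurable_weyl.
- by apply: measurable_funTS; apply/measurable_EFinP; exact: measurable_hp_weight.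
- by move=> x _; rewrite lee_fin hp_weight_ge0.
- exact: trivIset_setIr.
Qed.

HB.instance Definition _ := isMeasure.Build _ _ _ hp_unnormalized
  hp0 hp_ge0 hp_sigma_additive.

(* [mnormalize] divides by the total mass; the Dirac mass is only its fallback
   for a total mass equal to 0 or +oo, which does not occur for [Re s > -1/2]
   and [n >= 1]. *)
Definition hua_pickrell : probability (n.-tuple R) R :=
  mnormalize hp_unnormalized \d_([tuple of nseq n 0] : n.-tuple R).

End measures.
End hua_pickrell.

Section links.
Context {R : realType}.

HB.instance Definition _ := isPointed.Build R[i] 0.

(* Borel sigma-algebra on complex matrices, generated by the real and imaginary
   parts of the entries. *)
Definition mx_generators n : set (set 'M[R[i]]_n) :=
  [set B | exists i j, exists2 C : set R, measurable C &
    B = [set U : 'M[R[i]]_n | C (complex.Re (U i j))] \/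
    B = [set U : 'M[R[i]]_n | C (complex.Im (U i j))]].

Definition borel_mx n := g_sigma_algebraType (@mx_generators n).

(* Left invariance characterizes the Haar probability measure of a compact
   group. It is carried here by all matrices, with mass 1 on unitary ones. *)
Definition is_haar n (H : probability (borel_mx n) R) : Prop :=
  H [set U : 'M[R[i]]_n | U \is unitarymx] = 1%E /\
  forall V : 'M[R[i]]_n, V \is unitarymx ->
    forall B : set (borel_mx n), measurable B ->
      H [set U : 'M[R[i]]_n | B (V *m U)] = H B.

Definition corner n (A : 'M[R[i]]_n.+1) : 'M[R[i]]_n :=
  \matrix_(i, j) A (widen_ord (leqnSn n) i) (widen_ord (leqnSn n) j).

(* Nondecreasing list, with multiplicities, of the eigenvalues of a matrix whose
   eigenvalues are all real (junk otherwise). *)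
Definition ordered_eigenvalues n (A : 'M[R[i]]_n) : n.-tuple R :=
  xget [tuple of nseq n 0] [set y | weyl n y /\
    char_poly A = \prod_(i < n) ('X - ((tnth y i)%:C)%:P)].

Definition link_interior n (x : n.+1.-tuple R) (A : set (n.-tuple R)) : \bar R :=
  (\int[lebesgue_tuple n]_(y in A `&` interlace x)
     (n`!%:R * vandermonde y / vandermonde x)%:E)%E.

Definition link_corner n (H : probability (borel_mx n.+1) R)
    (x : n.+1.-tuple R) (A : set (n.-tuple R)) : \bar R :=
  H [set U : 'M[R[i]]_n.+1 | A (ordered_eigenvalues (corner
       (U ^t* *m diag_mx (\row_i (tnth x i)%:C) *m U)))].

(* The two formulas agree on the interior of [W^{n+1}]; the explicit density is
   the definition there, the corner law everywhere else. *)
Definition link n (H : probability (borel_mx n.+1) R)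
    (x : n.+1.-tuple R) (A : set (n.-tuple R)) : \bar R :=
  if x \in weyl_interior n.+1 then link_interior x A else link_corner H x A.

End links.

(* Main.v *)
(* Write [w_n] for the one-variable factor of the weight.  Since
   [Delta_{N+1}(x) prod_j w_{N+1}(x_j) = det [x_j^i w_{N+1}(x_j)]] and interlacing
   confines each [x_j] to its own interval, integrating out [x] against the link
   gives [N! Delta_N(y)] times the determinant of the moments of [w_{N+1}] on the
   gaps of [y].  The identity
     [(t^k w_N)' = (k t^{k-1} (1 + t^2) + t^k (2 Im s - 2 (Re s + N) t)) w_{N+1}]
   expresses all moments of positive degree through boundary values of [t^k w_N],
   so row reduction turns that determinant into a constant times
   [Delta_N(y) prod_j w_N(y_j)].  The same computation with weight [1] shows that
   the link has mass [1], which identifies the constant with the ratio of the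
   two normalizations.  Configurations with coinciding points have zero weight,
   so the value of the link there is irrelevant. *)

Require Import Defs.
From HB Require Import structures.
From mathcomp Require Import all_boot all_order all_algebra perm.
From mathcomp Require Import all_classical all_reals all_analysis.
From mathcomp Require Import measurable_realfun complex ring lra.

Set Implicit Arguments.
Unset Strict Implicit.
Unset Printing Implicit Defensive.

Import Order.TTheory GRing.Theory Num.Theory.
Import numFieldTopology.Exports numFieldNormedType.Exports.
Local Open Scope classical_set_scope.
Local Open Scope ring_scope.

(** * Determinants *)

Section determinants.
Context {F : comNzRingType}.

(** Partial column sums are right multiplication by the unitriangular matrix [T]. *)
Lemma det_cumulative n (M : 'M[F]_n) :
  \det (\matrix_(i, j) \sum_(k < n | (k <= j)%N) M i k) = \det M.
Proof.
pose T : 'M[F]_n := \matrix_(k, j) (k <= j)%:R.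
have -> : \matrix_(i, j) \sum_(k < n | (k <= j)%N) M i k = M *m T.
  apply/matrixP => i j; rewrite !mxE big_mkcond /=.
  by apply: eq_bigr => k _; rewrite mxE; case: leqP; rewrite ?mulr1 ?mulr0.
have dT : \det T = 1.
  rewrite -det_tr det_trig ?big1// => [i _|]; first by rewrite !mxE leqnn.
  by apply/is_trig_mxP => i j ij; rewrite !mxE leqNgt ij.
by rewrite det_mulmx dT mulr1.
Qed.

Lemma det_row0 n (W : 'M[F]_n.+1) :
  (forall j, W ord0 (lift ord0 j) = 0) ->
  \det W = W ord0 ord0 * \det (\matrix_(i, j) W (lift ord0 i) (lift ord0 j)).
Proof.
move=> W0; rewrite (expand_det_row _ ord0) big_ord_recl big1 ?addr0 => [|j _].
  rewrite /cofactor addn0 expr0 mul1r; congr (_ * \det _).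
  by apply/matrixP => i j; rewrite !mxE.
by rewrite W0 mul0r.
Qed.

Lemma det_col_max n (W : 'M[F]_n.+1) :
  (forall i, W (lift ord0 i) ord_max = 0) ->
  \det W = (-1) ^+ n * W ord0 ord_max *
           \det (\matrix_(i, j) W (lift ord0 i) (lift ord_max j)).
Proof.
move=> W0; rewrite (expand_det_col _ ord_max) big_ord_recl big1 ?addr0 => [|j _].
  rewrite /cofactor add0n mulrCA mulrA; congr (_ * \det _).
  by apply/matrixP => i j; rewrite !mxE.
by rewrite W0 mul0r.
Qed.

(** The partial sums of the differenced columns telescope back to [c]. *)
Lemma det_diff_cols n (c : 'I_n -> nat -> F) :
  \det (\matrix_(i, j) (c i j - (if j : nat is j'.+1 then c i j' else 0))) =
  \det (\matrix_(i, j < n) c i j).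
Proof.
rewrite -det_cumulative; congr (\det _); apply/matrixP => i j; rewrite !mxE.
under eq_bigr do rewrite mxE.
pose d k := c i k - (if k is k'.+1 then c i k' else 0).
transitivity (\sum_(k < j.+1) d k).
  rewrite (big_ord_widen_cond n xpredT d (ltn_ord j)).
  by apply: eq_bigl => k; rewrite ltnS.
elim: (nat_of_ord j) => [|m IH]; first by rewrite big_ord1 /d subr0.
by rewrite big_ord_recr /= IH /d; ring.
Qed.

Lemma det_scale_cols n (A : 'M[F]_n) (d : 'I_n -> F) :
  \det (\matrix_(i, j) (A i j * d j)) = \det A * \prod_(j < n) d j.
Proof.
have -> : \matrix_(i, j) (A i j * d j) = A *m diag_mx (\row_j d j).
  by apply/matrixP => i j; rewrite mul_mx_diag !mxE.
by rewrite det_mulmx det_diag; congr (_ * _); apply: eq_bigr => j _; rewrite mxE.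
Qed.

Lemma det_scale_rows n (A : 'M[F]_n) (d : 'I_n -> F) :
  \det (\matrix_(i, j) (d i * A i j)) = (\prod_(i < n) d i) * \det A.
Proof.
rewrite -det_tr mulrC -[in RHS]det_tr -det_scale_cols; congr (\det _).
by apply/matrixP => i j; rewrite !mxE mulrC.
Qed.

Lemma sum_delta_ord n p (f : nat -> F) : (p < n)%N ->
  \sum_(l < n) (l == p :> nat)%:R * f l = f p.
Proof.
move=> pn; rewrite (bigD1 (Ordinal pn)) //= eqxx mul1r big1 ?addr0// => l lp.
by rewrite (_ : (l == p :> nat) = false) ?mul0r//; apply/negbTE.
Qed.

(* Row reduction of a moment matrix [m] whose rows satisfy the three-term
   recurrence obtained by integrating an exact derivative. *)
Lemma det_recurrence n (m g : nat -> nat -> F) (al be ga : nat -> F) :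
  (forall k j, (k < n)%N -> (j <= n)%N ->
    al k * m k.+1 j + be k * m k j + ga k * m k.-1 j =
    if (j < n)%N then g k j else 0) ->
  (\prod_(k < n) al k) * \det (\matrix_(i, j < n.+1) m i j) =
  (-1) ^+ n * m 0%N n * \det (\matrix_(i, j < n) g i j).
Proof.
move=> rec.
(* Row 0 of [L] copies row 0 of [m]; row [k.+1] applies the recurrence of index [k]. Thus [L] is
   lower triangular with diagonal 1, al 0, ..., al (n - 1). *)
pose L : 'M[F]_n.+1 := \matrix_(i, l) if i : nat is k.+1 then
  al k * (l == k.+1 :> nat)%:R + be k * (l == k :> nat)%:R +
  ga k * (l == k.-1 :> nat)%:R else (l == 0%N :> nat)%:R.
have -> : \prod_(k < n) al k = \det L.
  rewrite det_trig.
    rewrite big_ord_recl !mxE /= mul1r; apply: eq_bigr => k _.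
    rewrite mxE lift0 eqxx mulr1 gtn_eqF// mulr0 addr0.
    by rewrite gtn_eqF ?mulr0 ?addr0// ltnS leq_pred.
  apply/is_trig_mxP => i l; rewrite mxE; case: (nat_of_ord i) => [|k] il.
    by rewrite gtn_eqF.
  rewrite (gtn_eqF il) (gtn_eqF (ltnW il)).
  by rewrite (gtn_eqF (leq_ltn_trans (leq_pred k) (ltnW il))) !mulr0 !addr0.
have LmE (k : 'I_n) (j : 'I_n.+1) :
    (L *m (\matrix_(i, j < n.+1) m i j)) (lift ord0 k) j =
    if (j < n)%N then g k j else 0.
  have k1 : (k.+1 < n.+1)%N := ltn_ord k.
  rewrite mxE -rec//; last exact: ltn_ord j.
  under eq_bigr => l _ do rewrite !mxE lift0 !mulrDl -!mulrA.
  rewrite !big_split /= -!mulr_sumr !(@sum_delta_ord _ _ (fun l => m l j))//.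
  - exact: leq_ltn_trans (leq_pred k) (ltnW k1).
  - exact: ltnW.
(* Only row 0 survives in the last column of the product, with entry [m 0 n]; its position (0, n)
   gives the sign. *)
rewrite -det_mulmx det_col_max; last by move=> i; rewrite LmE ltnn.
congr (_ * _ * _).
  rewrite mxE; under eq_bigr => l _ do rewrite !mxE.
  exact: (@sum_delta_ord _ _ (fun l => m l n)).
congr (\det _); apply/matrixP => i j.
by rewrite [LHS]mxE [RHS]mxE LmE lift_max ltn_ord.
Qed.

End determinants.

(** * Integrals of determinants over R^n *)

Section has_integral.
Context d (T : measurableType d) (R : realType).
Variable mu : {measure set T -> \bar R}.

(** Carrying integrability together with a real value lets linear combinations and products be
    computed in [R], away from undefined extended sums. *)
Definition has_integral (f : T -> R) (v : R) : Prop :=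
  mu.-integrable setT (EFin \o f) /\ (\int[mu]_x (f x)%:E = v%:E)%E.

Lemma has_integralZ (c : R) f v :
  has_integral f v -> has_integral (fun x => c * f x) (c * v).
Proof.
move=> [If fv]; split.
  exact: (@eq_integrable _ _ _ mu setT measurableT
    (fun x => c%:E * (f x)%:E)%E _ (fun x _ => erefl)
    (integrableZl measurableT c If)).
under eq_integral do rewrite EFinM.
by rewrite integralZl// fv.
Qed.

Lemma has_integral_sum (I : Type) (r : seq I) (P : pred I) (f : I -> T -> R)
    (v : I -> R) :
  (forall i, has_integral (f i) (v i)) ->
  has_integral (fun x => \sum_(i <- r | P i) f i x) (\sum_(i <- r | P i) v i).
Proof.
move=> fv; have If i := (fv i).1; split.
  apply: (@eq_integrable _ _ _ mu setT measurableT
    (fun x => \sum_(i <- r | P i) (f i x)%:E)%E) => [x _|].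
    by rewrite /= sumEFin.
  exact: (integrable_sum measurableT r (fun i _ => If i)).
under eq_integral do rewrite -sumEFin.
rewrite (integral_sum measurableT If) -sumEFin.
by apply: eq_bigr => i _; exact: (fv i).2.
Qed.

Lemma has_integral_ge0 (f : T -> R) (v : R) : measurable_fun setT f ->
  (forall x, 0 <= f x) -> (\int[mu]_x (f x)%:E = v%:E)%E -> has_integral f v.
Proof.
move=> mf f0 fv; split=> //; apply/integrableP; split.
  exact/measurable_EFinP.
under eq_integral do rewrite /= ger0_norm//.
by rewrite fv ltry.
Qed.

Lemma eq_has_integral (f g : T -> R) v : f =1 g ->
  has_integral f v -> has_integral g v.
Proof. by move=> /funext ->. Qed.

Lemma has_integral_unique f u v :
  has_integral f u -> has_integral f v -> u = v.
Proof. by move=> [_ fu] [_ fv]; move: fv; rewrite fu => -[]. Qed.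

(** Turning the domain into an indicator factor allows it to enter the entries of a determinant. *)
Lemma has_integral_indic (D : set T) (f : T -> R) (v : R) : measurable D ->
  mu.-integrable D (EFin \o f) -> (\int[mu]_(x in D) (f x)%:E = v%:E)%E ->
  has_integral (fun x => \1_D x * f x) v.
Proof.
move=> mD If fv.
have E : EFin \o (fun x => \1_D x * f x) = (EFin \o f) \_ D.
  apply/funext => x; rewrite patchE /= indicE.
  by case: ifPn => _; rewrite ?mul1r ?mul0r.
split; first by rewrite E; exact/(integrable_mkcond (EFin \o f) mD).
by rewrite -fv [RHS]integral_mkcond -E.
Qed.

Lemma has_integralD f g u v : has_integral f u -> has_integral g v ->
  has_integral (fun x => f x + g x) (u + v).
Proof.
move=> [If fu] [Ig gv]; split; first exact: (integrableD measurableT If Ig).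
under eq_integral do rewrite EFinD.
by rewrite integralD// fu gv.
Qed.

Lemma has_integralB f g u v : has_integral f u -> has_integral g v ->
  has_integral (fun x => f x - g x) (u - v).
Proof.
move=> fu gv; have := has_integralD fu (has_integralZ (-1) gv).
rewrite mulN1r; apply: eq_has_integral => x.
by rewrite mulN1r.
Qed.

End has_integral.

Section product_integrals.
Context {R : realType}.
Local Notation leb := (@lebesgue_measure R).

(** Fubini on the product, transported along [cons_pair], whose pushforward defines
    [lebesgue_tuple n.+1]. *)
Lemma has_integral_cons n (f : R -> R) (g : n.-tuple R -> R) u v :
  has_integral leb f u -> has_integral (lebesgue_tuple n) g v ->
  has_integral (lebesgue_tuple n.+1)
    (fun x => f (thead x) * g [tuple of behead x]) (u * v).
Proof.
move=> [If fu] [Ig gv].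
have mf : measurable_fun setT f by apply/measurable_EFinP; exact: measurable_int If.
have mg : measurable_fun setT g by apply/measurable_EFinP; exact: measurable_int Ig.
pose F := fun p : R * n.-tuple R => (f p.1 * g p.2)%:E.
have mF : measurable_fun setT F.
  apply/measurable_EFinP; apply: measurable_funM.
    by apply: measurableT_comp.
  by apply: measurableT_comp.
(* By Tonelli, the integral of the absolute value is a product of two finite integrals. *)
have IF : (leb \x lebesgue_tuple n)%E.-integrable setT F.
  apply/integrable12ltyP => //.
  under eq_integral => x _.
    under eq_integral => y _ do rewrite /F /= normrM EFinM.
    rewrite ge0_integralZl//; last first.
      by apply/measurable_EFinP; apply: measurableT_comp.
    over.
  rewrite /= ge0_integralZr//; last 2 first.
  - by apply/measurable_EFinP; apply: measurableT_comp.
  - exact: integral_ge0.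
  apply: lte_mul_pinfty.
  - exact: integral_ge0.
  - rewrite ge0_fin_numE ?integral_ge0//.
    by case/integrableP : If.
  - by case/integrableP : Ig.
have EF : (\int[(leb \x lebesgue_tuple n)%E]_p F p = (u * v)%:E)%E.
  rewrite -integral12_prod_meas1//.
  under eq_integral => x _.
    rewrite /fubini_F /F /=.
    under eq_integral => y _ do rewrite EFinM.
    rewrite integralZl// gv muleC.
    over.
  by rewrite integralZl// fu -EFinM mulrC.
have FE : F = (fun x : n.+1.-tuple R =>
    (f (thead x) * g [tuple of behead x])%:E) \o @cons_pair R n.
  apply/funext => -[a y]; rewrite /F /=; congr (_ * _)%:E; congr g.
  exact/val_inj.
have mG : measurable_fun setT (fun x : n.+1.-tuple R =>
    (f (thead x) * g [tuple of behead x])%:E).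
  apply/measurable_EFinP; apply: measurable_funM.
    by apply: measurableT_comp => //; exact: measurable_tnth.
  by apply: measurableT_comp => //; exact: measurable_behead.
rewrite FE in IF EF; split.
  apply: (@integrable_pushforward _ _ (measurableTypeR R * n.-tuple R)%type _ R
    (@cons_pair R n) (measurable_cons_pair (n := n))
    (leb \x lebesgue_tuple n)%E setT _ mG) => //.
rewrite -EF.
exact: (@integral_pushforward _ _ (measurableTypeR R * n.-tuple R)%type _ R
  (@cons_pair R n) (measurable_cons_pair (n := n))
  (leb \x lebesgue_tuple n)%E setT _ mG IF measurableT).
Qed.

Lemma has_integral_prod n (h : 'I_n -> R -> R) (m : 'I_n -> R) :
  (forall i, has_integral leb (h i) (m i)) ->
  has_integral (lebesgue_tuple n) (fun x => \prod_(i < n) h i (tnth x i))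
    (\prod_(i < n) m i).
Proof.
elim: n h m => [|n IH] h m hm.
  apply: has_integral_ge0.
  - under eq_fun do rewrite big_ord0; exact: measurable_cst.
  - by move=> x; rewrite big_ord0.
  - under eq_integral do rewrite big_ord0.
    by rewrite integral_dirac//= diracT mul1e big_ord0.
rewrite big_ord_recl; apply: eq_has_integral (has_integral_cons (hm ord0)
  (IH (fun i => h (lift ord0 i)) _ (fun i => hm (lift ord0 i)))) => x.
rewrite big_ord_recl; congr (_ * _); apply: eq_bigr => i _.
congr h; rewrite tnth_behead; congr (tnth _ _); apply/val_inj.
by rewrite /= inordK// ltnS.
Qed.

(** Column [j] involves only the variable x_j, so each term of the Leibniz expansion is a product of
    one-variable functions. *)
Lemma has_integral_det n (h : 'I_n -> 'I_n -> R -> R) (M : 'M[R]_n) :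
  (forall i j, has_integral leb (h i j) (M i j)) ->
  has_integral (lebesgue_tuple n)
    (fun x => \det (\matrix_(i, j) h i j (tnth x j))) (\det M).
Proof.
move=> hM.
have detE (A : 'M[R]_n) :
    \det A = \sum_(s : {perm 'I_n}) (-1) ^+ s * \prod_(j < n) A (s j) j.
  rewrite -det_tr; apply: eq_bigr => s _.
  by congr (_ * _); apply: eq_bigr => j _; rewrite mxE.
have hs (s : {perm 'I_n}) := has_integralZ ((-1) ^+ s)
  (has_integral_prod (fun j => hM (s j) j)).
rewrite detE; apply: eq_has_integral (has_integral_sum (index_enum _) xpredT hs).
move=> x; rewrite detE; apply: eq_bigr => s _.
by congr (_ * _); apply: eq_bigr => j _; rewrite !mxE.
Qed.

End product_integrals.

(** * Integrals of exact derivatives and Hua-Pickrell moments *)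

Section one_variable.
Context {R : realType}.
Local Notation leb := (@lebesgue_measure R).

Lemma is_derive_continuous (F : R -> R) (x l : R) :
  is_derive x 1 F l -> {for x, continuous F}.
Proof. by move=> [dF _]; apply/differentiable_continuous/derivable1_diffP. Qed.

Lemma has_integral_itv (F f : R -> R) (a b : R) : a <= b ->
  (forall x : R, is_derive x 1 F (f x)) -> continuous f ->
  has_integral leb (fun x => \1_(`[a, b]%classic) x * f x) (F b - F a).
Proof.
(* The fundamental theorem of calculus takes [a < b]; the degenerate segment arises when consecutive
   points coincide. *)
rewrite le_eqVlt => /predU1P[<- dF cf|ab dF cf].
  apply: has_integral_indic => //; last first.
    by rewrite set_itv1 integral_set1 subrr.
  apply: continuous_compact_integrable; first exact: segment_compact.
  exact: continuous_subspaceT.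
apply: has_integral_indic => //.
  apply: continuous_compact_integrable; first exact: segment_compact.
  exact: continuous_subspaceT.
have cF x : {for x, continuous F} by exact: is_derive_continuous (dF x).
rewrite (continuous_FTC2 (F := F) ab)//.
- exact: continuous_subspaceT.
- split => //.
  + by apply: cvg_at_right_filter; exact: cF.
  + by apply: cvg_at_left_filter; exact: cF.
- by move=> x _; rewrite derive1E; exact: derive_val.
Qed.

(** Dominated convergence with bound [|f|]; the sets [D n] must only contain each point
    eventually. *)
Lemma has_integral_exhaust (D : (set R)^nat) (f : R -> R) (v : R^nat) (l : R) :
  leb.-integrable setT (EFin \o f) -> (forall n, measurable (D n)) ->
  (forall x, \forall n \near \oo, D n x) ->
  (\forall n \near \oo, has_integral leb (fun x => \1_(D n) x * f x) (v n)) ->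
  v @ \oo --> l -> has_integral leb f l.
Proof.
move=> If mD DT fv vl; split => //.
have mf : measurable_fun setT f by apply/measurable_EFinP; exact: measurable_int If.
have cv : (\int[leb]_x (\1_(D n) x * f x)%:E)%E @[n --> \oo] -->
    (\int[leb]_x (f x)%:E)%E.
  have mDf n : measurable_fun setT (fun x => (\1_(D n) x * f x)%:E).
    by apply/measurable_EFinP; apply: measurable_funM.
  have f_f : {ae leb, forall x, setT x ->
      (\1_(D n) x * f x)%:E @[n --> \oo] --> (EFin \o f) x}.
    apply: aeW => x _; apply: cvg_near_cst; near=> n.
    by rewrite indicE mem_set ?mul1r//; near: n; exact: DT.
  have f_g : {ae leb, forall x n, setT x ->
      `|(\1_(D n) x * f x)%:E| <= (abse \o (EFin \o f)) x}%E.
    apply: aeW => x n _; rewrite /= lee_fin normrM ler_piMl//.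
    by rewrite indicE normr_nat lern1 leq_b1.
  by have [] := @dominated_convergence _ _ _ leb setT measurableT _ _ _ mDf
    (measurable_int _ If) f_f (integrable_abse If) f_g.
have ev : EFin \o v @ \oo --> l%:E by apply: cvg_EFin => //; exact: nearW.
apply: (cvg_unique _ cv) => //.
apply: cvg_trans ev; apply: near_eq_cvg; near=> n => /=.
by apply/esym; have [] : has_integral leb (fun x => \1_(D n) x * f x) (v n)
  by near: n; exact: fv.
Unshelve. all: by end_near. Qed.

End one_variable.

Section pointwise_derivatives.
Context {R : realType}.
Implicit Types (f g : R -> R) (x : R).

Lemma is_derive1_add f g x df dg : is_derive x 1 f df -> is_derive x 1 g dg ->
  is_derive x 1 (fun t => f t + g t) (df + dg).
Proof. by move=> df' dg'; exact: is_deriveD. Qed.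

Lemma is_derive1_mul f g x df dg : is_derive x 1 f df -> is_derive x 1 g dg ->
  is_derive x 1 (fun t => f t * g t) (f x * dg + g x * df).
Proof. by move=> df' dg'; exact: is_deriveM. Qed.

Lemma is_derive1_exprn (n : nat) x :
  is_derive x 1 (fun t => t ^+ n) (n%:R * x ^+ n.-1).
Proof.
have := @is_deriveX R R id n x 1 1 (is_derive_id _ _).
rewrite /GRing.scale /= mulr1.
by rewrite (_ : id ^+ n = fun t => t ^+ n)//; apply/funext => t; rewrite fctE.
Qed.

End pointwise_derivatives.

(** * Integrability of powers of 1 + x^2 *)

Section cauchy_weight.
Context {R : realType}.
Local Notation leb := (@lebesgue_measure R).

Lemma cvg_powRN_pinfty (c : R) : 0 < c -> x `^ (- c) @[x --> +oo] --> 0.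
Proof.
move=> c0; apply/cvgr0Pnorm_lt => e e0; near=> x.
have x0 : 0 < x by near: x; exact: nbhs_pinfty_gt.
(* For x > 0, x^(-c) is below e exactly when x exceeds e^(-1/c). *)
have ec : 0 < e `^ (- c^-1) by rewrite powR_gt0.
rewrite ger0_norm ?powR_ge0// powRN invf_plt ?posrE ?powR_gt0//.
have -> : e^-1 = (e `^ (- c^-1)) `^ c.
  by rewrite -powRrM mulNr mulVf ?gt_eqF// powR_inv1// ltW.
by apply: gt0_ltr_powR; rewrite ?nnegrE ?(ltW ec) ?(ltW x0)//;
  near: x; exact: nbhs_pinfty_gt.
Unshelve. all: by end_near. Qed.

Lemma is_derive_1DpowR (b x : R) : 0 <= x ->
  is_derive x 1 (fun t => (1 + t) `^ b) (b * (1 + x) `^ (b - 1)).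
Proof.
move=> x0.
have x1 : 0 < 1 + x by rewrite ltr_pwDl.
have dx : is_derive x (1 : R) (fun t : R => 1 + t) 1.
  by rewrite -[X in is_derive _ _ _ X]add0r; exact: is_derive1_add.
by have := is_derive1_comp (is_derive1_powR b x1) dx; rewrite mulr1.
Qed.

(** Comparison integral for [integrable_cauchy_powR], from the antiderivative (1 + x)^(1 - b) / (1 -
    b). *)
Lemma integral_1DpowR (b : R) : 1 < b ->
  (\int[leb]_(x in `[0%R, +oo[) ((1 + x) `^ (- b))%:E = ((b - 1)^-1)%:E)%E.
Proof.
move=> b1; have b0 : 1 - b < 0 by rewrite subr_lt0.
pose F (x : R) := (1 - b)^-1 * (1 + x) `^ (1 - b).
have dF (x : R) : 0 <= x -> is_derive x 1 F ((1 + x) `^ (- b)).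
  move=> x0.
  have := is_derive1_mul (is_derive_cst (1 - b)^-1 x 1)
    (is_derive_1DpowR (1 - b) x0).
  rewrite mulr0 addr0 mulrA mulVf ?lt_eqF// mul1r.
  by rewrite (_ : 1 - b - 1 = - b) //; ring.
rewrite (@ge0_continuous_FTC2y _ _ F 0 0).
- by rewrite /F addr0 powR1 mulr1 -EFinB sub0r -invrN opprB.
- by move=> x _; exact: powR_ge0.
- apply: continuous_in_subspaceT => x; rewrite inE/= in_itv/= andbT => x0.
  exact: is_derive_continuous (is_derive_1DpowR _ x0).
- rewrite -(mulr0 (1 - b)^-1); apply: cvgMr.
  have := @cvg_powRN_pinfty (b - 1); rewrite subr_gt0 opprB => /(_ b1).
  apply: cvg_comp; apply/cvgryPge => A.
  by near=> x; rewrite -lerBlDl; near: x; apply: nbhs_pinfty_ge; rewrite num_real.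
- by move=> x x0; have [] := dF x (ltW x0).
- apply: cvg_at_right_filter.
  exact: is_derive_continuous (dF _ (lexx _)).
- move=> x; rewrite in_itv/= andbT => x0; rewrite derive1E.
  by have [_ ->] := dF x (ltW x0).
Unshelve. all: by end_near. Qed.

Definition cauchy_powR (a x : R) := (1 + x ^+ 2) `^ (- a).

Lemma one_sqr_gt0 (x : R) : 0 < 1 + x ^+ 2.
Proof. by rewrite ltr_pwDl ?sqr_ge0. Qed.

Lemma is_derive_one_sqr_powR (b x : R) :
  is_derive x 1 (fun t => (1 + t ^+ 2) `^ b)
    (2 * b * x * (1 + x ^+ 2) `^ (b - 1)).
Proof.
have dx : is_derive x (1 : R) (fun t : R => 1 + t ^+ 2) (2 * x).
  rewrite -[X in is_derive _ _ _ X]add0r.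
  exact: is_derive1_add (is_derive1_exprn 2 x).
have := @is_derive1_comp _ (@powR R ^~ b) _ x _ _
  (is_derive1_powR b (one_sqr_gt0 x)) dx.
by rewrite (_ : _ * (2 * x) = 2 * b * x * (1 + x ^+ 2) `^ (b - 1)) //; ring.
Qed.

Lemma continuous_cauchy_powR a : continuous (cauchy_powR a).
Proof. by move=> x; exact: is_derive_continuous (is_derive_one_sqr_powR _ _). Qed.

Lemma cauchy_powR_ge0 a x : 0 <= cauchy_powR a x.
Proof. exact: powR_ge0. Qed.

(** Obtained from (1 + x)^2 <= 2 (1 + x^2), that is (1 - x)^2 >= 0, raised to the power [a]. *)
Lemma cauchy_powR_le a x : 0 <= a -> 0 <= x ->
  cauchy_powR a x <= 2 `^ a * (1 + x) `^ (- (2 * a)).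
Proof.
move=> a0 x0.
have key : ((1 + x) ^+ 2) `^ a <= 2 `^ a * (1 + x ^+ 2) `^ a.
  rewrite -powRM ?(ltW (one_sqr_gt0 x))//; apply: ge0_ler_powR => //.
  - by rewrite nnegrE sqr_ge0.
  - by rewrite nnegrE mulr_ge0 ?(ltW (one_sqr_gt0 x)).
  - by rewrite -subr_ge0 [leRHS](_ : _ = (1 - x) ^+ 2) ?sqr_ge0//; ring.
rewrite /cauchy_powR !powRN powRrM powR_mulrn ?addr_ge0//.
rewrite ler_pdivlMr ?powR_gt0 ?exprn_gt0 ?ltr_pwDl// mulrC.
by rewrite ler_pdivrMr ?powR_gt0 ?one_sqr_gt0.
Qed.

(** Evenness reduces to the half-line, where a multiple of (1 + x)^(-2a) with 2a > 1 dominates. *)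
Lemma integrable_cauchy_powR (a : R) : 1 / 2 < a ->
  leb.-integrable setT (EFin \o cauchy_powR a).
Proof.
move=> ha; have a0 : 0 <= a by lra.
have mc : measurable_fun setT (cauchy_powR a).
  by apply: continuous_measurable_fun; exact: continuous_cauchy_powR.
apply/integrableP; split; first exact/measurable_EFinP.
under eq_integral do rewrite /= ger0_norm ?cauchy_powR_ge0//.
rewrite ge0_symfun_integralT; last 3 first.
- exact: cauchy_powR_ge0.
- exact: continuous_cauchy_powR.
- by move=> x; rewrite /cauchy_powR /= sqrrN.
apply: lte_mul_pinfty => //.
rewrite -set_itvcy.
apply: (@le_lt_trans _ _
  (\int[leb]_(x in `[0%R, +oo[) (2 `^ a * (1 + x) `^ (- (2 * a)))%:E)%E).
  apply: ge0_le_integral => //.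
  - by move=> x _; rewrite lee_fin cauchy_powR_ge0.
  - by apply/measurable_EFinP; exact: measurable_funTS.
  - apply/measurable_EFinP; apply: measurable_funM => //.
    apply: (measurableT_comp (measurable_powR _)).
    by apply: measurable_funD.
  - move=> x /=; rewrite in_itv/= andbT => x0.
    by rewrite lee_fin cauchy_powR_le.
under eq_integral do rewrite EFinM.
rewrite ge0_integralZl//; last 2 first.
- apply/measurable_EFinP.
  apply: (measurableT_comp (measurable_powR _)).
  by apply: measurable_funD.
- by move=> x _; rewrite lee_fin powR_ge0.
by rewrite integral_1DpowR -?EFinM ?ltry//; lra.
Qed.

End cauchy_weight.

(** * Exact derivatives integrated over half-lines and the line *)

Section half_lines.
Context {R : realType}.
Local Notation leb := (@lebesgue_measure R).
Variables F f : R -> R.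
Hypothesis dF : forall x : R, is_derive x 1 F (f x).
Hypothesis cf : continuous f.
Hypothesis If : leb.-integrable setT (EFin \o f).
Hypothesis FNy : F (- n%:R) @[n --> \oo] --> (0 : R).

Lemma near_natr_ge (x : R) : \forall n \near \oo, x <= n%:R.
Proof.
have := @cvgr_idn R => /cvgryPge /(_ x); exact.
Qed.

(** The segments [-n, a] exhaust the half-line, and the boundary term F(-n) tends to 0. *)
Lemma has_integral_Ny (a : R) :
  has_integral leb (fun x => \1_(`]-oo, a]%classic) x * f x) (F a).
Proof.
pose D n : set R := `[- n%:R, +oo[%classic.
apply: (@has_integral_exhaust _ D _ (fun n => F a - F (- n%:R))).
- have := integrable_mkcond (mu := leb) (EFin \o f)
    (measurable_itv (`]-oo, a] : interval R)).
  rewrite (_ : (EFin \o f) \_ `]-oo, a] =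
    EFin \o (fun x => \1_(`]-oo, a]%classic) x * f x)); last first.
    apply/funext => x; rewrite patchE /= indicE.
    by case: ifPn => _; rewrite ?mul1r ?mul0r.
  move=> <-; exact: (integrableS measurableT).
- by move=> n; exact: measurable_itv.
- move=> x; near=> n; rewrite /D /= in_itv/= andbT lerNl.
  by near: n; exact: near_natr_ge.
- near=> n; have na : - n%:R <= a by rewrite lerNl; near: n; exact: near_natr_ge.
  apply: eq_has_integral (has_integral_itv na dF cf) => x.
  rewrite mulrA; congr (_ * _); rewrite !indicE !mem_setE !in_itv/= andbT.
  by case: (- n%:R <= x); rewrite ?mul1r ?mul0r.
- rewrite -[X in _ --> X](subr0 (F a)); apply: cvgB => //; exact: cvg_cst.
Unshelve. all: by end_near. Qed.

Lemma has_integral_line : F n%:R @[n --> \oo] --> (0 : R) ->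
  has_integral leb f 0.
Proof.
move=> Fy; apply: (@has_integral_exhaust _ (fun n => `]-oo, n%:R]%classic) _
  (fun n => F n%:R)) => //.
- by move=> x; near=> n; rewrite /= in_itv/=; near: n; exact: near_natr_ge.
- by near=> n; exact: has_integral_Ny.
Unshelve. all: by end_near. Qed.

End half_lines.

(** * Derivatives and bounds of the Hua-Pickrell moments *)

Section hua_pickrell_factor.
Context {R : realType}.
Local Notation leb := (@lebesgue_measure R).
Variable s : R[i].
Local Notation a := (complex.Re s).
Local Notation b := (complex.Im s).

Lemma hp_factorE n t : hp_factor s n t =
  (1 + t ^+ 2) `^ (- a - n%:R) * expR (2 * b * atan t).
Proof. by rewrite /hp_factor Arg_1Di. Qed.

Lemma hp_factor_gt0 n t : 0 < hp_factor s n t.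
Proof. by rewrite mulr_gt0 ?expR_gt0 ?powR_gt0 ?one_sqr_gt0. Qed.

(** With c = - a - n this passes from level [n] to level [n.+1] of [hp_factor] at the cost of a
    factor 1 + x^2. *)
Lemma one_sqr_powRB1 (c x : R) :
  (1 + x ^+ 2) `^ c = (1 + x ^+ 2) * (1 + x ^+ 2) `^ (c - 1).
Proof.
have x0 := one_sqr_gt0 x.
rewrite -{2}(powRr1 (ltW x0)) -powRD; last by rewrite (gt_eqF x0) implybT.
by congr (_ `^ _); ring.
Qed.

(** The logarithmic derivative is (2b - 2(a + n) x) / (1 + x^2); raising the level from [n] to
    [n.+1] absorbs the denominator. *)
Lemma is_derive_hp_factor n (x : R) : is_derive x 1 (hp_factor s n)
  ((2 * b - 2 * (a + n%:R) * x) * hp_factor s n.+1 x).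
Proof.
have -> : hp_factor s n =
    fun t => (1 + t ^+ 2) `^ (- a - n%:R) * expR (2 * b * atan t).
  by apply/funext => t; exact: hp_factorE.
have dat := is_derive1_mul (is_derive_cst (2 * b) x 1) (is_derive1_atan x).
have de := @is_derive1_comp _ expR (fun t => 2 * b * atan t) x _ _
  (is_derive_expR (2 * b * atan x)) dat.
have := is_derive1_mul (is_derive_one_sqr_powR (- a - n%:R) x) de.
rewrite hp_factorE (one_sqr_powRB1 (- a - n%:R)) -(natr1 n).
rewrite (_ : - a - (n%:R + 1) = - a - n%:R - 1); last by ring.
move=> /is_derive_eq; apply; rewrite mulr0 addr0.
by rewrite /=; field; rewrite gt_eqF ?one_sqr_gt0.
Qed.

Lemma continuous_hp_factor n : continuous (hp_factor s n).
Proof. by move=> x; exact: is_derive_continuous (is_derive_hp_factor _ _). Qed.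

Definition hp_moment n k (t : R) := t ^+ k * hp_factor s n t.

Lemma continuous_hp_moment n k : continuous (hp_moment n k).
Proof.
by move=> x; apply: cvgM; [exact: exprn_continuous|exact: continuous_hp_factor].
Qed.

Lemma is_derive_hp_moment n k (x : R) : is_derive x 1 (hp_moment n k)
  ((k%:R - 2 * (a + n%:R)) * hp_moment n.+1 k.+1 x + 2 * b * hp_moment n.+1 k x +
   k%:R * hp_moment n.+1 k.-1 x).
Proof.
have := is_derive1_mul (is_derive1_exprn k x) (is_derive_hp_factor n x).
move=> /is_derive_eq; apply.
have -> : hp_factor s n x = (1 + x ^+ 2) * hp_factor s n.+1 x.
  rewrite !hp_factorE mulrA (one_sqr_powRB1 (- a - n%:R)) -(natr1 n).
  by rewrite (_ : - a - (n%:R + 1) = - a - n%:R - 1)//; ring.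
(* For k = 0 the truncated [k.-1] is again 0, but its coefficient [k%:R] vanishes. *)
rewrite /hp_moment; case: k => [|k] /=; first by rewrite !expr0 expr1; ring.
by rewrite !exprS; ring.
Qed.

(** Since |t| <= 1 + t^2, the moment is bounded by a power of 1 + t^2 with exponent k - a - n <= -(a
    + 1), times the exponential, where |atan t| <= pi. *)
Lemma hp_moment_le n k t : (k < n)%N ->
  `|hp_moment n k t| <= expR (2 * `|b| * pi) * cauchy_powR (a + 1) t.
Proof.
move=> kn; rewrite /hp_moment normrM normrX (ger0_norm (ltW (hp_factor_gt0 n t))).
have u1 : 1 <= 1 + t ^+ 2 by rewrite lerDl sqr_ge0.
have tk : `|t| ^+ k <= (1 + t ^+ 2) ^+ k.
  rewrite lerXn2r ?nnegrE ?normr_ge0 ?(ltW (one_sqr_gt0 t))//.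
  rewrite -real_normK ?num_real//; have := sqr_ge0 (`|t| - 1); nra.
rewrite hp_factorE mulrA mulrC ler_pM ?mulr_ge0 ?expR_ge0 ?powR_ge0 ?exprn_ge0//.
  rewrite ler_expR -!mulrA ler_pM2l//.
  rewrite (le_trans (ler_norm _))// normrM ler_wpM2l//.
  rewrite ler_norml; apply/andP; split.
    by rewrite (le_trans _ (ltW (atan_gtNpi2 t)))// lerN2 ler_piMr ?pi_ge0//; lra.
  by rewrite (le_trans (ltW (atan_ltpi2 t)))// ler_piMr ?pi_ge0//; lra.
rewrite (le_trans (ler_wpM2r (powR_ge0 _ _) tk))//.
rewrite -powR_mulrn ?(ltW (one_sqr_gt0 t))// -powRD; last first.
  by rewrite (gt_eqF (one_sqr_gt0 t)) implybT.
rewrite /cauchy_powR; apply: ler_powR => //.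
have : k.+1%:R <= n%:R :> R by rewrite ler_nat.
by rewrite -(natr1 k); lra.
Qed.

Hypothesis ha : - (1 / 2) < a.

(** The bound has exponent a + 1 > 1/2, so at level N + 1 all moments up to degree N are finite. *)
Lemma integrable_hp_moment n k : (k < n)%N ->
  leb.-integrable setT (EFin \o hp_moment n k).
Proof.
move=> kn; have ha1 : 1 / 2 < a + 1 by move: ha; lra.
apply: (le_integrable measurableT _ _
  (integrableZl measurableT (expR (2 * `|b| * pi)) (integrable_cauchy_powR ha1))).
  apply/measurable_EFinP; apply: continuous_measurable_fun.
  exact: continuous_hp_moment.
move=> x _; rewrite /= lee_fin (le_trans (hp_moment_le x kn))//.
exact: ler_norm.
Qed.

(** The condition on |u m| serves both ends of the line at once, through u m = m and u m = -m. *)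
Lemma cvg_hp_moment n k (u : R^nat) : (k < n)%N ->
  (forall m, `|u m| = m%:R) -> hp_moment n k (u m) @[m --> \oo] --> (0 : R).
Proof.
move=> kn un; apply/norm_cvg0P.
apply: (@squeeze_cvgr _ _ _ _ (cst 0) (fun m => expR (2 * `|b| * pi) *
    (1 + (m%:R : R) ^+ 2) `^ (- (a + 1)))); last 2 first.
- exact: cvg_cst.
- rewrite -(mulr0 (expR (2 * `|b| * pi))); apply: cvgM; first exact: cvg_cst.
  have ha1 : 0 < a + 1 by move: ha; lra.
  have := cvg_powRN_pinfty ha1; apply: cvg_comp; apply/cvgryPge => A.
  near=> m; have : A <= m%:R by near: m; exact: near_natr_ge.
  by have := sqr_ge0 ((m%:R : R) - 1); nra.
apply: nearW => m; apply/andP; split; first exact: normr_ge0.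
apply: (le_trans (hp_moment_le _ kn)).
by rewrite /cauchy_powR -real_normK ?num_real// un.
Unshelve. all: by end_near. Qed.

Lemma continuous_derive_hp_moment n k : continuous (fun x : R =>
  (k%:R - 2 * (a + n%:R)) * hp_moment n.+1 k.+1 x + 2 * b * hp_moment n.+1 k x +
   k%:R * hp_moment n.+1 k.-1 x).
Proof.
move=> x; apply: cvgD; first apply: cvgD.
all: by apply: cvgM; [exact: cvg_cst|exact: continuous_hp_moment].
Qed.

End hua_pickrell_factor.

(** * Interlacing *)

Section gaps.
Context {R : realType}.
Local Notation leb := (@lebesgue_measure R).

(* The closed intervals into which [y] cuts the line, from [`]-oo, y`_0]] for
   [j = 0] to [`[y`_n.-1, +oo[] for [j = n]. *)
Definition gap n (y : n.-tuple R) (j : nat) : set R :=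
  [set t | ((0 < j)%N ==> (y`_j.-1 <= t)) && ((j < n)%N ==> (t <= y`_j))].

(** Decouples the constraint on [x] for fixed [y]: every x_j is confined to its own gap,
    independently of the others. *)
Lemma interlaceP n (x : n.+1.-tuple R) (y : n.-tuple R) :
  interlace x y <-> forall j : 'I_n.+1, gap y j (tnth x j).
Proof.
split=> [xy j|xy i]; last first.
  have i1 : (i < n.+1)%N := ltnW (ltn_ord i).
  have /andP[_] := xy (Ordinal i1); have /andP[+ _] := xy (lift ord0 i).
  by rewrite !(tnth_nth 0) lift0 /= ltn_ord /= => -> ->.
rewrite /gap /= (tnth_nth 0); apply/andP; split; apply/implyP.
  case: j => -[//|j] /= jn _; have jn' : (j < n)%N by [].
  by have /andP[] := xy (Ordinal jn').
by move=> jn; have /andP[] := xy (Ordinal jn).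
Qed.

Lemma interlace_weyl n (x : n.+1.-tuple R) (y : n.-tuple R) :
  interlace x y -> weyl n.+1 x /\ weyl n y.
Proof.
move=> xy; split; apply/(sortedP 0) => i; rewrite size_tuple => i1.
  by have /andP[] := xy (Ordinal (i1 : (i < n)%N)); exact: le_trans.
have /andP[_] := xy (Ordinal (ltnW i1)); have /andP[+ _] := xy (Ordinal i1).
by move=> /= h1 h2; exact: le_trans h2 h1.
Qed.

Section cumulative_integral.
Variable f : R -> R.
Hypothesis If : leb.-integrable setT (EFin \o f).

(** By convention the point of index [n] is +oo, so that index yields the total integral. *)
Definition cumulative_integral n (y : n.-tuple R) (j : nat) : R :=
  if (j < n)%N then fine (\int[leb]_(x in `]-oo, y`_j]) (f x)%:E)%E
  else fine (\int[leb]_x (f x)%:E)%E.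

Definition below n (y : n.-tuple R) (j : nat) : set R :=
  [set t | (j < n)%N ==> (t <= y`_j)].

Lemma has_integral_below n (y : n.-tuple R) j :
  has_integral leb (fun t => \1_(below y j) t * f t) (cumulative_integral y j).
Proof.
rewrite /below /cumulative_integral; case: ifPn => jn.
  have -> : [set t | true ==> (t <= y`_j)] = `]-oo, y`_j]%classic.
    by apply/seteqP; split => t /=; rewrite in_itv.
  have Iy : leb.-integrable `]-oo, y`_j] (EFin \o f).
    exact: integrableS If.
  apply: has_integral_indic => //.
  by rewrite fineK//; exact: integrable_fin_num Iy.
have -> : [set t | false ==> (t <= y`_j)] = setT by apply/seteqP; split.
apply: has_integral_indic => //.
by rewrite fineK//; exact: integrable_fin_num If.
Qed.

Lemma has_integral_gap n (y : n.-tuple R) j : (j <= n)%N -> weyl n y ->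
  has_integral leb (fun t => \1_(gap y j) t * f t)
    (cumulative_integral y j -
     (if j is j'.+1 then cumulative_integral y j' else 0)).
Proof.
case: j => [|j] jn wy.
  by rewrite subr0; apply: eq_has_integral (has_integral_below y 0).
(* A gap contains its left endpoint, which the difference of two [below] sets misses; the null
   singleton restores it. *)
have h0 : has_integral leb (fun t => \1_[set y`_j] t * f t) 0.
  apply: has_integral_indic => //; last by rewrite integral_set1.
  exact: integrableS If.
have := has_integralD
  (has_integralB (has_integral_below y j.+1) (has_integral_below y j)) h0.
rewrite addr0; apply: eq_has_integral => t.
rewrite -mulrBl -mulrDl; congr (_ * _); rewrite !indicE /gap /below.
rewrite !mem_setE classical_sets.in_set1 !unfold_in /= jn /=.
have [tj|jt|->] := ltgtP t y`_j; last first.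
- case: (ltnP j.+1 n) => j1n /=; last by rewrite subrr add0r.
  rewrite (_ : y`_j <= y`_j.+1) ?subrr ?add0r//.
  by move/(sortedP 0): wy; apply; rewrite size_tuple.
- by rewrite subr0 addr0.
- rewrite addr0; case: (ltnP j.+1 n) => j1n /=; last by rewrite subrr.
  rewrite (_ : t <= y`_j.+1) ?subrr//; apply: le_trans (ltW tj) _.
  by move/(sortedP 0): wy; apply; rewrite size_tuple.
Qed.

End cumulative_integral.

End gaps.

(** * Integrals over interlacing configurations *)

Section core_identities.
Context {R : realType}.
Local Notation leb := (@lebesgue_measure R).

Lemma vandermonde_det n (x : n.-tuple R) :
  vandermonde x = \det (\matrix_(i, j < n) tnth x j ^+ i).
Proof.
have := det_Vandermonde (\row_j tnth x j).
rewrite [X in \det X](_ : _ = \matrix_(i, j < n) tnth x j ^+ i); last first.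
  by apply/matrixP => i j; rewrite !mxE.
move=> ->; apply: eq_bigr => i _; apply: eq_bigr => j _; by rewrite !mxE.
Qed.

(** Splits the interlacing indicator into one factor per column, ready to be absorbed in a
    determinant. *)
Lemma prod_gap_indic n (x : n.+1.-tuple R) (y : n.-tuple R) :
  \prod_(j < n.+1) \1_(gap y j) (tnth x j) =
  \1_[set x | interlace x y] x :> R.
Proof.
rewrite indicE; case: (boolP (x \in _)).
  rewrite inE /= => /interlaceP xy; rewrite big1// => j _.
  by rewrite indicE mem_set.
rewrite notin_setE /= => xy.
have [j xj] : exists j : 'I_n.+1, ~ gap y j (tnth x j).
  by apply: contrapT => /forallNP H; apply/xy/interlaceP => j; apply: contrapT.
by rewrite (bigD1 j)//= indicE memNset// mul0r.
Qed.

Section hua_pickrell_step.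
Variables (s : R[i]) (N : nat).
Local Notation a := (complex.Re s).
Local Notation b := (complex.Im s).
Hypothesis ha : - (1 / 2) < a.

Definition hp_mass : R :=
  fine (\int[leb]_t (hp_factor s N.+1 t)%:E)%E.

(** The product collects, up to sign, the leading coefficients of the moment recurrence; [hp_mass]
    is the moment of degree 0 over the whole line, left over by the row reduction. *)
Definition hp_const : R := hp_mass / \prod_(k < N) (2 * (a + N%:R) - k%:R).

Let moment i j (y : N.-tuple R) :=
  cumulative_integral (hp_moment s N.+1 i) y j.

(** The derivative of t^k w_N is integrated up to y_j, or over the whole line when j = N; boundary
    terms at infinity vanish because k < N. *)
Lemma moment_recurrence (y : N.-tuple R) k j : (k < N)%N -> (j <= N)%N ->
  (k%:R - 2 * (a + N%:R)) * moment k.+1 j y + 2 * b * moment k j y +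
  k%:R * moment k.-1 j y = if (j < N)%N then hp_moment s N k y`_j else 0.
Proof.
move=> kN jN.
have I l : (l <= N)%N -> leb.-integrable setT (EFin \o hp_moment s N.+1 l).
  by move=> lN; exact: integrable_hp_moment.
have I1 := I _ kN; have I2 := I _ (ltnW kN).
have I3 := I _ (leq_trans (leq_pred k) (ltnW kN)).
have B l (Il : leb.-integrable setT (EFin \o hp_moment s N.+1 l)) :=
  has_integral_below Il y j.
have := has_integralD (has_integralD
  (has_integralZ (k%:R - 2 * (a + N%:R)) (B _ I1)) (has_integralZ (2 * b) (B _ I2)))
  (has_integralZ k%:R (B _ I3)).
have ID : leb.-integrable setT (EFin \o (fun x : R =>
    (k%:R - 2 * (a + N%:R)) * hp_moment s N.+1 k.+1 x +
    2 * b * hp_moment s N.+1 k x + k%:R * hp_moment s N.+1 k.-1 x)).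
  exact: (integrableD measurableT (integrableD measurableT
    (integrableZl measurableT _ I1) (integrableZl measurableT _ I2))
    (integrableZl measurableT _ I3)).
have FNy := cvg_hp_moment ha kN (fun m => etrans (normrN _) (normr_nat _ m)).
have Fy := cvg_hp_moment ha kN (fun m => normr_nat R m).
have dF (x : R) := is_derive_hp_moment s N k x.
have cf := @continuous_derive_hp_moment R s N k.
(* One integral over [below y j] is evaluated twice: by linearity, and as that of an exact
   derivative. *)
move=> /has_integral_unique; apply.
rewrite /below; case: ifPn => jN'.
  apply: eq_has_integral (has_integral_Ny dF cf ID FNy y`_j) => t.
  rewrite (_ : \1_(`]-oo, y`_j]%classic) t = \1_[set t | true ==> (t <= y`_j)] t :> R).
    by rewrite !mulrDr; congr (_ + _ + _); rewrite mulrCA.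
  by congr (\1_ _ _); apply/seteqP; split => u /=; rewrite in_itv.
apply: eq_has_integral (has_integral_line dF cf ID FNy Fy) => t.
rewrite (_ : [set t | false ==> (t <= y`_j)] = setT).
  by rewrite indicE in_setT !mul1r.
by apply/seteqP; split.
Qed.

(** With k <= N - 1 and 2a > -1, every factor exceeds N. *)
Lemma hp_prod_gt0 : 0 < \prod_(k < N) (2 * (a + N%:R) - k%:R).
Proof.
apply: prodr_gt0 => k _; have : k.+1%:R <= N%:R :> R by rewrite ler_nat.
by rewrite -(natr1 k); move: ha (ler0n R N); lra.
Qed.

Lemma has_integral_hp_mass : has_integral leb (hp_factor s N.+1) hp_mass.
Proof.
have := integrable_hp_moment ha (ltn0Sn N).
rewrite (_ : hp_moment s N.+1 0 = hp_factor s N.+1) => [I0|]; last first.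
  by apply/funext => t; rewrite /hp_moment mul1r.
by split => //; rewrite fineK//; exact: integrable_fin_num I0.
Qed.

(** A positive function with integral 0 would make the whole line null, although [0, 1] has length
    1. *)
Lemma hp_mass_gt0 : 0 < hp_mass.
Proof.
have [I0 E] := has_integral_hp_mass.
rewrite -lte_fin -E lt_neqAle; apply/andP; split; last first.
  by apply: integral_ge0 => x _; rewrite lee_fin ltW ?hp_factor_gt0.
apply/negP => /eqP w0.
have := (ae_eq_integral_abs leb measurableT (measurable_int _ I0)).1.
under eq_integral do rewrite /= (ger0_norm (ltW (hp_factor_gt0 _ _ _))).
rewrite -w0 => /(_ erefl) [Z [mZ Z0 ZT]].
have {}ZT : Z = setT.
  apply/seteqP; split=> // t _; apply: ZT => /= /(_ I) [wt].
  by have := hp_factor_gt0 s N.+1 t; rewrite wt ltxx.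
have : (leb `[0%R, 1%R]%classic <= leb Z)%E.
  by rewrite ZT; apply: le_measure; rewrite ?inE//; exact: measurable_itv.
by rewrite Z0 lebesgue_measure_itv/= lte_fin ltr01 oppr0 adde0 lee_fin ler10.
Qed.

Lemma hp_const_gt0 : 0 < hp_const.
Proof. by rewrite divr_gt0 ?hp_mass_gt0 ?hp_prod_gt0. Qed.

(** Undoing the column differences leaves cumulative moments, which the recurrence row-reduces to a
    Vandermonde matrix with weighted columns. *)
Lemma det_gap_moments (y : N.-tuple R) :
  \det (\matrix_(i, j < N.+1) (moment i j y -
     (if j : nat is j'.+1 then moment i j' y else 0))) =
  hp_const * (vandermonde y * \prod_(j < N) hp_factor s N (tnth y j)).
Proof.
rewrite (det_diff_cols (fun i j => moment i j y)).
have := det_recurrence (m := fun i j => moment i j y)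
  (g := fun k j => hp_moment s N k y`_j) (moment_recurrence y).
have -> : \det (\matrix_(i, j < N) hp_moment s N i y`_j) =
    vandermonde y * \prod_(j < N) hp_factor s N (tnth y j).
  rewrite vandermonde_det -det_scale_cols; congr (\det _).
  by apply/matrixP => i j; rewrite !mxE (tnth_nth 0).
have -> : moment 0 N y = hp_mass.
  rewrite /moment /cumulative_integral ltnn /hp_mass; congr fine.
  by apply: eq_integral => t _; rewrite /hp_moment mul1r.
(* The sign (-1)^N extracted here cancels the one that [det_recurrence] produces. *)
have -> : \prod_(k < N) (k%:R - 2 * (a + N%:R)) =
    (-1) ^+ N * \prod_(k < N) (2 * (a + N%:R) - k%:R).
  rewrite -[X in (-1) ^+ X](card_ord N) -prodrN.
  by apply: eq_bigr => k _; rewrite opprB.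
rewrite -!mulrA => /(mulfI (negbT (signr_eq0 _ _))) H.
apply: (mulfI (lt0r_neq0 hp_prod_gt0)); rewrite H /hp_const.
by rewrite [RHS]mulrCA mulVKf ?lt0r_neq0 ?hp_prod_gt0.
Qed.

(** Weights and gap indicators are scaled into the columns of the Vandermonde matrix, so the
    integral is the determinant of the gap moments. *)
Lemma has_integral_hp_link (y : N.-tuple R) : weyl N y ->
  has_integral (lebesgue_tuple N.+1)
    (fun x => \1_[set x | interlace x y] x *
       (vandermonde x * \prod_(j < N.+1) hp_factor s N.+1 (tnth x j)))
    (hp_const * (vandermonde y * \prod_(j < N) hp_factor s N (tnth y j))).
Proof.
move=> wy; rewrite -det_gap_moments.
have I l : (l <= N)%N -> leb.-integrable setT (EFin \o hp_moment s N.+1 l).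
  by move=> lN; exact: integrable_hp_moment.
have := @has_integral_det R N.+1
  (fun i j t => \1_(gap y j) t * hp_moment s N.+1 i t)
  (\matrix_(i, j < N.+1) (moment i j y -
     (if j : nat is j'.+1 then moment i j' y else 0))).
have h (i j : 'I_N.+1) : has_integral leb
    (fun t => \1_(gap y j) t * hp_moment s N.+1 i t)
    ((\matrix_(i, j < N.+1) (moment i j y -
     (if j : nat is j'.+1 then moment i j' y else 0))) i j).
  have [iN jN] : (i <= N)%N /\ (j <= N)%N by split; rewrite -ltnS.
  rewrite mxE; exact (has_integral_gap (I i iN) jN wy).
move=> /(_ h); apply: eq_has_integral => x.
rewrite vandermonde_det -det_scale_cols -prod_gap_indic mulrC -det_scale_cols.
congr (\det _); apply/matrixP => i j; rewrite !mxE /hp_moment; ring.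
Qed.

End hua_pickrell_step.

(** For fixed [x] each y_j ranges over [x_j, x_{j+1}], and the integrated entries are differences of
    powers of consecutive points, ties included. *)
Lemma has_integral_link n (x : n.+1.-tuple R) : weyl n.+1 x ->
  has_integral (lebesgue_tuple n)
    (fun y => \1_[set y | interlace x y] y * (n`!%:R * vandermonde y))
    (vandermonde x).
Proof.
move=> wx; rewrite vandermonde_det.
have -> : \det (\matrix_(i, j < n.+1) tnth x j ^+ i) =
    \det (\matrix_(i, j < n) (x`_j.+1 ^+ i.+1 - x`_j ^+ i.+1)).
  transitivity (\det (\matrix_(i, j < n.+1) x`_j ^+ i)).
    congr (\det _); apply/matrixP => i j; rewrite !mxE (tnth_nth 0)//.
  (* Differencing the columns turns the first row, all ones, into (1, 0, ..., 0), and expanding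
     along it removes it. *)
  rewrite -(det_diff_cols (fun i j => x`_j ^+ i)) det_row0.
    rewrite mxE /= subr0 mul1r; congr (\det _); apply/matrixP => i j.
    by rewrite !mxE !lift0.
  by move=> j; rewrite mxE lift0 /= !expr0 subrr.
have h (i j : 'I_n) : has_integral leb
    (fun t => \1_(`[x`_j, x`_j.+1]%classic) t * (i.+1%:R * t ^+ i))
    ((\matrix_(i, j < n) (x`_j.+1 ^+ i.+1 - x`_j ^+ i.+1)) i j).
  rewrite mxE; apply: (@has_integral_itv R (fun t => t ^+ i.+1)).
  - by move/(sortedP 0): wx; apply; rewrite size_tuple ltnS.
  - by move=> t; exact: is_derive1_exprn.
  - by move=> t; apply: cvgM; [exact: cvg_cst|exact: exprn_continuous].
apply: eq_has_integral (has_integral_det h) => y.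
have -> : \1_[set y | interlace x y] y =
    \prod_(j < n) \1_(`[x`_j, x`_j.+1]%classic) (tnth y j) :> R.
  rewrite indicE; case: (boolP (y \in _)).
    rewrite inE /= => xy; rewrite big1// => j _.
    by rewrite indicE mem_set//= in_itv/= (tnth_nth 0) xy.
  rewrite notin_setE /= => xy.
  have [j xj] : exists j : 'I_n, ~ (x`_j <= y`_j <= x`_j.+1).
    by apply: contrapT => /forallNP H; apply: xy => j; apply: contrapT.
  rewrite (bigD1 j)//= indicE memNset ?mul0r//=.
  by rewrite in_itv/= (tnth_nth 0).
(* The factorial is spread over the rows, so that t^i becomes the derivative of t^(i + 1). *)
have -> : n`!%:R = \prod_(i < n) i.+1%:R :> R.
  by rewrite -natr_prod fact_prod big_add1 big_mkord.
rewrite vandermonde_det -det_scale_rows mulrC -det_scale_cols.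
congr (\det _); apply/matrixP => i j; rewrite !mxE; ring.
Qed.

End core_identities.

(** * Consistency of the measures *)

Section ge0_integrals.
Local Open Scope ereal_scope.
Context d (T : measurableType d) (R : realType).
Implicit Types mu nu : {measure set T -> \bar R}.

Import HBNNSimple.

(** A nonnegative integral is a supremum over simple functions below the integrand, hence monotone
    without measurability. This serves for [link], whose measurability in [x] is not established. *)
Lemma ge0_le_integral_nonmeasurable mu (D : set T) (f g : T -> \bar R) :
  (forall x, D x -> 0 <= f x) -> (forall x, D x -> f x <= g x) ->
  \int[mu]_(x in D) f x <= \int[mu]_(x in D) g x.
Proof.
move=> f0 fg; have g0 x : D x -> 0 <= g x.
  by move=> Dx; exact: le_trans (f0 _ Dx) (fg _ Dx).
rewrite !ge0_integralE//; apply: le_ereal_sup => _ /= [h hf <-].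
exists h => // x; apply: le_trans (hf x) _.
by rewrite !patchE; case: ifPn => // /set_mem; exact: fg.
Qed.

Lemma ge0_integral_eq_off_null mu (D Z : set T) (f g : T -> \bar R) :
  measurable D -> measurable Z -> mu Z = 0 -> measurable_fun D g ->
  (forall x, D x -> 0 <= f x) -> (forall x, D x -> 0 <= g x) ->
  (forall x, D x -> ~ Z x -> f x = g x) ->
  \int[mu]_(x in D) f x = \int[mu]_(x in D) g x.
Proof.
move=> mD mZ Z0 mg f0 g0 fg.
(* [g' 0] and [g' +oo] are measurable, have the integral of [g], and enclose [f] whatever its values
   on [Z]. *)
pose g' (c : \bar R) x := if x \in Z then c else g x.
have mg' c : measurable_fun D (g' c).
  apply: measurable_fun_if => //.
  - apply: measurable_funTS; apply: (measurable_fun_bool true).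
    rewrite setTI (_ : _ @^-1` _ = Z)//.
    by apply/seteqP; split=> x /=; [exact: set_mem|exact: mem_set].
  - by apply: measurable_funS mg => //; exact: subIsetl.
have g'E c : 0 <= c -> \int[mu]_(x in D) g' c x = \int[mu]_(x in D) g x.
  move=> c0; apply: ge0_ae_eq_integral => //.
    by move=> x Dx; rewrite /g'; case: ifP => // _; exact: g0.
  exists Z; split => // x /= /not_implyP[_]; rewrite /g'.
  by case: ifPn => // /set_mem.
apply/eqP; rewrite eq_le; apply/andP; split.
- rewrite -(g'E +oo)//; apply: ge0_le_integral_nonmeasurable => // x Dx.
  by rewrite /g'; case: ifPn; rewrite ?leey// notin_setE => /fg ->.
- rewrite -(g'E 0)//; apply: ge0_le_integral_nonmeasurable => x Dx.
    by rewrite /g'; case: ifPn => // _; exact: g0.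
  rewrite /g'; case: ifPn => [_|]; first exact: f0.
  by rewrite notin_setE => /fg ->.
Qed.

(** Linearity settles simple functions, and monotone convergence extends the formula to [f]. *)
Lemma ge0_integral_density mu nu (g : T -> R) (f : T -> \bar R) :
  measurable_fun setT g -> (forall x, 0 <= g x)%R ->
  (forall A, measurable A -> nu A = \int[mu]_(x in A) (g x)%:E) ->
  measurable_fun setT f -> (forall x, 0 <= f x) ->
  \int[nu]_x f x = \int[mu]_x (f x * (g x)%:E).
Proof.
move=> mg g0 nuE mf f0.
pose f_ := nnsfun_approx measurableT mf.
transitivity (limn (fun n => \int[nu]_x (f_ n x)%:E)).
  rewrite -monotone_convergence//.
  - apply: eq_integral => y _; apply/esym/cvg_lim => //.
    exact: cvg_nnsfun_approx.
  - by move=> n; exact/measurable_EFinP/measurable_funP.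
  - by move=> n y _; rewrite lee_fin.
  - by move=> y _ m n mn; rewrite lee_fin; exact/lefP/nd_nnsfun_approx.
transitivity (limn (fun n => \int[mu]_x ((f_ n x)%:E * (g x)%:E))); last first.
  rewrite -monotone_convergence//.
  - apply: eq_integral => y _; apply/cvg_lim => //.
    apply: cvgeZr => //.
    exact: cvg_nnsfun_approx.
  - move=> n; apply: emeasurable_funM; last exact/measurable_EFinP.
    exact/measurable_EFinP/measurable_funP.
  - by move=> n y _; rewrite mule_ge0// lee_fin.
  - move=> y _ m n mn; apply: lee_wpmul2r; rewrite lee_fin//.
    exact/lefP/nd_nnsfun_approx.
(* It remains to treat a single simple function, expanded over its finitely many values. *)
congr (limn _); apply/funext => n.
have mh r : measurable (f_ n @^-1` [set r]) by exact: measurable_sfunP.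
under eq_integral do rewrite fimfunE -fsumEFin//.
rewrite ge0_integral_fsum//; last 2 first.
- by move=> r; exact/measurable_EFinP/measurable_funM.
- by move=> r x _; rewrite nnfun_muleindic_ge0.
under [RHS]eq_integral => x _.
  rewrite fimfunE -fsumEFin// ge0_mule_fsuml; last first.
    by move=> r; rewrite EFinM nnfun_muleindic_ge0.
  over.
rewrite [RHS]ge0_integral_fsum//; last 2 first.
- move=> r; apply: emeasurable_funM; last exact/measurable_EFinP.
  exact/measurable_EFinP/measurable_funM.
- by move=> r x _; rewrite mule_ge0 ?lee_fin// -lee_fin EFinM nnfun_muleindic_ge0.
apply: eq_fsbigr => r /set_mem [x _ <-].
under [RHS]eq_integral do rewrite EFinM -muleA.
rewrite ge0_integralZl//; last 3 first.
- by apply: emeasurable_funM; apply/measurable_EFinP.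
- by move=> y _; rewrite mule_ge0// lee_fin.
- by rewrite lee_fin.
under eq_integral do rewrite EFinM.
rewrite ge0_integralZl ?lee_fin//; last first.
  exact/measurable_EFinP.
rewrite integral_indic// setIT nuE// integral_mkcond; congr (_ * _).
apply: eq_integral => y _; rewrite patchE indicE.
by case: ifPn => _; rewrite ?mul1e ?mul0e.
Qed.

End ge0_integrals.

(** * Measurability, and the interior of the chamber *)

Section measurability.
Context {R : realType}.

Lemma measurable_nth n k : measurable_fun setT (fun x : n.-tuple R => x`_k).
Proof.
have [kn|nk] := ltnP k n.
  under eq_fun => x do rewrite -(tnth_nth 0 x (Ordinal kn)).
  exact: measurable_tnth.
by under eq_fun do rewrite nth_default ?size_tuple//; exact: measurable_cst.
Qed.

Lemma measurable_vandermonde n : measurable_fun setT (@vandermonde R n).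
Proof.
apply: measurable_prod => i _.
under eq_fun do rewrite big_mkcond.
apply: measurable_prod => j _ /=; case: (i < j)%N; last exact: measurable_cst.
by apply: measurable_funB; exact: measurable_tnth.
Qed.

Lemma measurable_interlace n :
  measurable [set p : n.+1.-tuple R * n.-tuple R | interlace p.1 p.2].
Proof.
rewrite (_ : [set p | _] = \bigcap_(i in [set: 'I_n])
    ([set p : n.+1.-tuple R * n.-tuple R | p.1`_i <= p.2`_i] `&`
     [set p : n.+1.-tuple R * n.-tuple R | p.2`_i <= p.1`_i.+1])).
  apply: fin_bigcap_measurable => // i _; apply: measurableI;
    rewrite -[X in measurable X]setTI; apply: measurable_fun_le => //;
    by apply: (measurableT_comp (measurable_nth _)).
apply/seteqP; split => p /= H i; first by move=> _; split=> /=; have /andP[] := H i.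
by have [/= -> ->] := H i Logic.I.
Qed.

Lemma vandermonde_ge0 n (x : n.-tuple R) : weyl n x -> 0 <= vandermonde x.
Proof.
move=> wx; apply: prodr_ge0 => i _; apply: prodr_ge0 => j ij.
rewrite subr_ge0 !(tnth_nth 0) (sorted_leq_nth le_trans lexx)//.
- by rewrite inE size_tuple.
- by rewrite inE size_tuple.
- exact: ltnW.
Qed.

(** A nonzero Vandermonde product makes the order strict, and finitely many strict inequalities
    persist in a neighbourhood. *)
Lemma vandermonde_neq0_interior n (x : n.-tuple R) :
  weyl n x -> vandermonde x != 0 -> weyl_interior n x.
Proof.
move=> wx x0; exists (\row_i tnth x i); last first.
  by apply: eq_from_tnth => i; rewrite tnth_mktuple mxE.
have lt_x (i j : 'I_n) : (i < j)%N -> tnth x i < tnth x j.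
  move=> ij; rewrite lt_neqAle; apply/andP; split; last first.
    rewrite !(tnth_nth 0) (sorted_leq_nth le_trans lexx) ?inE ?size_tuple//.
    exact: ltnW.
  apply: contra_neq x0 => xij; rewrite /vandermonde.
  by rewrite (bigD1 i)//= (bigD1 j)//= xij subrr mul0r mul0r.
have near_lt (p : 'I_n * 'I_n) : (p.1 < p.2)%N ->
    \forall v \near (\row_i tnth x i : 'rV[R]_n), (v : 'rV[R]_n) ord0 p.1 < v ord0 p.2.
  move=> /lt_x xp.
  have c k : (v : 'rV[R]_n) ord0 k @[v --> (\row_i tnth x i : 'rV[R]_n)] -->
      (\row_i tnth x i : 'rV[R]_n) ord0 k by exact: coord_continuous.
  have := cvgr_gt _ (cvgB (c p.2) (c p.1)) 0.
  rewrite !mxE subr_gt0 => /(_ _ _ xp); apply: filterS => v.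
  by rewrite subr_gt0.
have : \forall v \near (\row_i tnth x i : 'rV[R]_n),
    forall p : 'I_n * 'I_n, (p.1 < p.2)%N -> (v : 'rV[R]_n) ord0 p.1 < v ord0 p.2.
  apply: (@filter_forall _ _ (fun (p : 'I_n * 'I_n) (v : 'rV[R]_n) =>
    (p.1 < p.2)%N -> v ord0 p.1 < v ord0 p.2) _ (nbhs_filter _)) => p.
  case: (ltnP p.1 p.2) => [/near_lt|_].
    by apply: filterS => v H _.
  by apply: nearW.
apply: filterS => v H /=; apply/(sortedP 0) => i; rewrite size_tuple => i1.
have i0 := ltnW i1.
rewrite -(tnth_nth 0 _ (Ordinal i0)) -(tnth_nth 0 _ (Ordinal i1)) !tnth_mktuple.
exact: ltW (H (Ordinal i0, Ordinal i1) (ltnSn i)).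
Qed.

End measurability.

(** * Unnormalized consistency and total masses *)

Section assembly.
Context {R : realType}.

(** The indicator is taken on pairs, for the joint measurability that Tonelli asks; its slices in
    [x] and in [y] are convertible to it. *)
Definition link_density n (x : n.+1.-tuple R) (y : n.-tuple R) : R :=
  \1_[set p : n.+1.-tuple R * n.-tuple R | interlace p.1 p.2] (x, y) *
  (n`!%:R * vandermonde y / vandermonde x).

Lemma link_densityE n (x : n.+1.-tuple R) (y : n.-tuple R) :
  link_density x y = \1_[set y | interlace x y] y *
    (n`!%:R * vandermonde y / vandermonde x).
Proof. by []. Qed.

Lemma link_densityEl n (x : n.+1.-tuple R) (y : n.-tuple R) :
  link_density x y = \1_[set x | interlace x y] x *
    (n`!%:R * vandermonde y / vandermonde x).
Proof. by []. Qed.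

Lemma link_density_ge0 n (x : n.+1.-tuple R) (y : n.-tuple R) :
  0 <= link_density x y.
Proof.
rewrite /link_density indicE; case: (boolP ((x, y) \in _)); last by rewrite mul0r.
rewrite inE /= => /interlace_weyl[wx wy].
by rewrite mul1r divr_ge0 ?mulr_ge0 ?vandermonde_ge0.
Qed.

Lemma measurable_link_density n :
  measurable_fun setT (fun p : n.+1.-tuple R * n.-tuple R => link_density p.1 p.2).
Proof.
(* The inverse is traded for the measurable power -1; the two agree since the Vandermonde product is
   nonnegative where the indicator is nonzero. *)
rewrite (_ : (fun _ => _) = (fun p : n.+1.-tuple R * n.-tuple R =>
    \1_[set p : n.+1.-tuple R * n.-tuple R | interlace p.1 p.2] p *
    (n`!%:R * vandermonde p.2 * vandermonde p.1 `^ (- 1)))).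
  apply: measurable_funM.
    by apply: measurable_indic; exact: measurable_interlace.
  apply: measurable_funM; last first.
    apply: (measurableT_comp (measurable_powR _)).
    by apply: measurableT_comp => //; exact: measurable_vandermonde.
  apply: measurable_funM => //.
  by apply: measurableT_comp => //; exact: measurable_vandermonde.
apply/funext => -[x y]; rewrite /link_density indicE /=.
case: (boolP ((x, y) \in _)); last by rewrite !mul0r.
rewrite inE /= => /interlace_weyl[wx wy].
by rewrite powR_inv1// vandermonde_ge0.
Qed.

Lemma link_interiorE n (x : n.+1.-tuple R) A :
  (link_interior x A =
   \int[lebesgue_tuple n]_y (\1_A y * link_density x y)%:E)%E.
Proof.
rewrite /link_interior integral_mkcond; apply: eq_integral => y _.
rewrite patchE in_setI link_densityE !indicE.
rewrite -[[set y | interlace x y]]/(interlace x : set (n.-tuple R)).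
by case: (y \in A); case: (y \in _); rewrite /= ?mul1r ?mul0r.
Qed.

Lemma measurable_link_interior n (A : set (n.-tuple R)) : measurable A ->
  measurable_fun setT (fun x : n.+1.-tuple R => link_interior x A).
Proof.
move=> mA; under eq_fun do rewrite link_interiorE.
apply: (measurable_fun_fubini_tonelli_F (fun p : n.+1.-tuple R * n.-tuple R =>
  (\1_A p.2 * link_density p.1 p.2)%:E)).
- apply/measurable_EFinP; apply: measurable_funM.
    by apply: (measurableT_comp (measurable_indic _)).
  exact: measurable_link_density.
- by move=> p; rewrite lee_fin mulr_ge0 ?link_density_ge0.
Qed.

Lemma link_interior_ge0 n (x : n.+1.-tuple R) A : (0 <= link_interior x A)%E.
Proof.
rewrite link_interiorE; apply: integral_ge0 => y _.
by rewrite lee_fin mulr_ge0 ?link_density_ge0.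
Qed.

Lemma link_interiorT n (x : n.+1.-tuple R) : weyl n.+1 x ->
  vandermonde x != 0 -> (link_interior x setT = 1)%E.
Proof.
move=> wx x0; have [_] := has_integralZ (vandermonde x)^-1 (has_integral_link wx).
rewrite mulVf// => <-; rewrite link_interiorE; apply: eq_integral => y _.
rewrite indicT mul1r link_densityE; congr (_%:E); ring.
Qed.

Section hua_pickrell.
Variable s : R[i].
Hypothesis ha : - (1 / 2) < complex.Re s.

(** With the chamber moved into the weight, this is the density of [hp_unnormalized] on the whole
    space. *)
Definition weyl_weight n (x : n.-tuple R) : R := hp_weight s x * \1_(weyl n) x.

Lemma measurable_weyl_weight n : measurable_fun setT (@weyl_weight n).
Proof.
apply: measurable_funM; first exact: measurable_hp_weight.
by apply: measurable_indic; exact: measurable_weyl.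
Qed.

Lemma weyl_weight_ge0 n (x : n.-tuple R) : 0 <= weyl_weight x.
Proof. by rewrite mulr_ge0 ?hp_weight_ge0. Qed.

Lemma hp_unnormalizedE n A :
  (hp_unnormalized s A = \int[lebesgue_tuple n]_(x in A) (weyl_weight x)%:E)%E.
Proof.
rewrite /hp_unnormalized integral_mkcondr; apply: eq_integral => x _.
by rewrite patchE /weyl_weight indicE; case: ifP; rewrite ?mulr1 ?mulr0.
Qed.

Lemma link_density_weight n (x : n.+1.-tuple R) (y : n.-tuple R) :
  link_density x y * weyl_weight x = n`!%:R * vandermonde y *
    (\1_[set x | interlace x y] x *
     (vandermonde x * \prod_(j < n.+1) hp_factor s n.+1 (tnth x j))).
Proof.
rewrite link_densityEl /weyl_weight /hp_weight !indicE.
have [|] := boolP (x \in [set x | interlace x y]); last by rewrite !mul0r mulr0.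
rewrite inE /= => /interlace_weyl[wx _]; rewrite mem_set// !mul1r mulr1.
(* At coinciding points both sides vanish; elsewhere one factor of the squared Vandermonde product
   cancels the denominator. *)
have [->|x0] := eqVneq (vandermonde x) 0; last by field.
by rewrite invr0 !mulr0 !mul0r mulr0.
Qed.

(** Consistency before normalization: after Tonelli, the inner integral over [x] is given by
    [has_integral_hp_link]. *)
Lemma integral_link_interior_weight n (A : set (n.-tuple R)) : measurable A ->
  (\int[lebesgue_tuple n.+1]_x (link_interior x A * (weyl_weight x)%:E) =
   (n`!%:R * hp_const s n)%:E * hp_unnormalized s A)%E.
Proof.
move=> mA; pose f (p : n.+1.-tuple R * n.-tuple R) :=
  (\1_A p.2 * (link_density p.1 p.2 * weyl_weight p.1))%:E.
have mf : measurable_fun setT f.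
  apply/measurable_EFinP; apply: measurable_funM.
    by apply: (measurableT_comp (measurable_indic _)).
  apply: measurable_funM; first exact: measurable_link_density.
  by apply: measurableT_comp => //; exact: measurable_weyl_weight.
have f0 p : (0 <= f p)%E.
  rewrite /f lee_fin; apply: mulr_ge0 => //; apply: mulr_ge0.
    exact: link_density_ge0.
  exact: weyl_weight_ge0.
transitivity (\int[lebesgue_tuple n.+1]_x \int[lebesgue_tuple n]_y f (x, y))%E.
  apply: eq_integral => x _; rewrite link_interiorE -ge0_integralZr//.
  - by apply: eq_integral => y _; rewrite -EFinM -mulrA.
  - apply/measurable_EFinP; apply: measurable_funM.
      exact: measurable_indic.
    exact: (measurableT_comp (@measurable_link_density n) (pair1_measurable x)).
  - by move=> y _; rewrite lee_fin mulr_ge0 ?link_density_ge0.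
  - by rewrite lee_fin weyl_weight_ge0.
rewrite fubini_tonelli//.
have c0 : 0 <= n`!%:R * hp_const s n by rewrite mulr_ge0// ltW ?hp_const_gt0.
transitivity (\int[lebesgue_tuple n]_(y in A)
    ((n`!%:R * hp_const s n)%:E * (weyl_weight y)%:E))%E; last first.
  rewrite hp_unnormalizedE ge0_integralZl//.
  - apply/measurable_EFinP; apply: measurable_funTS; exact: measurable_weyl_weight.
  - by move=> y _; rewrite lee_fin weyl_weight_ge0.
rewrite [RHS]integral_mkcond; apply: eq_integral => y _; rewrite patchE /f /=.
rewrite indicE; case: ifPn => yA; last first.
  by under eq_integral do rewrite mul0r; rewrite integral0.
under eq_integral do rewrite mul1r link_density_weight.
have [wy|nwy] := boolP (y \in weyl n).
  have := has_integral_hp_link ha (set_mem wy).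
  move=> /(has_integralZ (n`!%:R * vandermonde y)) [_ ->].
  rewrite -EFinM /weyl_weight /hp_weight indicE wy mulr1; congr (_%:E); ring.
(* No [x] interlaces with an unordered [y], so both sides vanish. *)
rewrite /weyl_weight indicE (negbTE nwy) mulr0 mule0.
apply: integral0_eq => x _; rewrite indicE memNset ?mul0r ?mulr0//.
by move=> /= /interlace_weyl[_]; move: nwy; rewrite notin_setE.
Qed.

(** The case of the whole space: the link has mass 1 wherever the weight is nonzero, which yields
    the ratio of total masses. *)
Lemma hp_unnormalizedS n : (hp_unnormalized s [set: n.+1.-tuple R] =
  (n`!%:R * hp_const s n)%:E * hp_unnormalized s [set: n.-tuple R])%E.
Proof.
rewrite -integral_link_interior_weight// hp_unnormalizedE.
apply: eq_integral => x _; rewrite /weyl_weight /hp_weight.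
have [->|x0] := eqVneq (vandermonde x) 0.
  by rewrite expr0n /= !mul0r mule0.
rewrite indicE; case: (boolP (x \in weyl n.+1)) => wx; last by rewrite mulr0 mule0.
by rewrite link_interiorT ?mul1e//; exact: set_mem wx.
Qed.

(** Induction starting from a point of mass 1. A finite positive mass rules out the fallback of
    [mnormalize]. *)
Lemma hp_unnormalized_gt0 n :
  exists2 c : R, 0 < c & (hp_unnormalized s [set: n.-tuple R] = c%:E)%E.
Proof.
elim: n => [|n [c c0 E]].
  exists 1 => //; rewrite hp_unnormalizedE integral_dirac//; last first.
    by apply/measurable_EFinP; exact: measurable_weyl_weight.
  rewrite diracT mul1e /weyl_weight /hp_weight /vandermonde !big_ord0.
  by rewrite indicE mem_set// expr1n !mulr1.
exists (n`!%:R * hp_const s n * c); last by rewrite hp_unnormalizedS E.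
rewrite mulr_gt0// mulr_gt0 ?ltr0n ?fact_gt0//; exact: hp_const_gt0.
Qed.

Lemma hua_pickrellE n A (c : R) : 0 < c ->
  (hp_unnormalized s [set: n.-tuple R] = c%:E)%E ->
  (hua_pickrell s n A = hp_unnormalized s A * (c^-1)%:E)%E.
Proof.
move=> c0 E; rewrite /hua_pickrell /= /mnormalize /= E.
by rewrite eqe gt_eqF.
Qed.

Lemma ge0_integral_hua_pickrell n (f : n.-tuple R -> \bar R) (c : R) : 0 < c ->
  (hp_unnormalized s [set: n.-tuple R] = c%:E)%E ->
  measurable_fun setT f -> (forall x, 0 <= f x)%E ->
  (\int[hua_pickrell s n]_x f x =
   (\int[lebesgue_tuple n]_x (f x * (weyl_weight x)%:E)) * (c^-1)%:E)%E.
Proof.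
move=> c0 E mf f0; have ci0 : 0 <= c^-1 by rewrite invr_ge0 ltW.
rewrite (@ge0_integral_density _ _ _ (lebesgue_tuple n) _
  (fun x => weyl_weight x * c^-1))//.
- rewrite -ge0_integralZr ?lee_fin//.
  + by apply: eq_integral => x _; rewrite EFinM muleA.
  + apply: emeasurable_funM => //; apply/measurable_EFinP.
    exact: measurable_weyl_weight.
  + by move=> x _; rewrite mule_ge0 ?lee_fin ?weyl_weight_ge0.
- by apply: measurable_funM => //; exact: measurable_weyl_weight.
- by move=> x; rewrite mulr_ge0 ?weyl_weight_ge0.
- move=> A mA; apply: etrans (hua_pickrellE A c0 E) _; rewrite hp_unnormalizedE.
  rewrite -ge0_integralZr ?lee_fin//.
  + apply/measurable_EFinP; apply: measurable_funTS; exact: measurable_weyl_weight.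
  + by move=> x _; rewrite lee_fin weyl_weight_ge0.
Qed.

(** The density contains the squared Vandermonde product and the chamber indicator, and one of them
    vanishes at each such point. *)
Lemma hua_pickrell_null n :
  hua_pickrell s n ([set x | vandermonde x = 0] `|` ~` weyl n) = 0%E.
Proof.
have [c c0 E] := hp_unnormalized_gt0 n.
apply: etrans (hua_pickrellE _ c0 E) _.
rewrite hp_unnormalizedE integral0_eq ?mul0e// => x.
rewrite /weyl_weight /hp_weight => -[->|nx].
  by rewrite expr0n /= !mul0r.
by rewrite indicE memNset// mulr0.
Qed.

End hua_pickrell.
End assembly.

Theorem corollary5p2 (R : realType) (s : R[i])
    (hs : - (1 / 2) < complex.Re s)
    (N : nat) (hN : (1 <= N)%N)
    (H : probability (@borel_mx R N.+1) R) (hH : is_haar H)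
    (A : set (N.-tuple R)) (mA : measurable A) :
  (\int[hua_pickrell s N.+1]_(x in weyl N.+1) link H x A
   = hua_pickrell s N A)%E.
Proof.
have [c c0 cE] := hp_unnormalized_gt0 hs N.
have [c' c'0 c'E] := hp_unnormalized_gt0 hs N.+1.
have mV : measurable [set x : N.+1.-tuple R | vandermonde x = 0].
  have := @measurable_vandermonde R N.+1 measurableT [set 0] (measurable_set1 0).
  by rewrite setTI.
pose Z := [set x : N.+1.-tuple R | vandermonde x = 0] `|` ~` weyl N.+1.
have mZ : measurable Z.
  by apply: measurableU => //; apply: measurableC; exact: measurable_weyl.
pose f x := if x \in weyl N.+1 then link H x A else 0%E.
transitivity (\int[hua_pickrell s N.+1]_x f x)%E.
  by rewrite integral_mkcond; apply: eq_integral => x _; rewrite patchE.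
(* The corner law and the zero values off the chamber are confined to the null set [Z], so the
   explicit kernel can replace [f]. *)
rewrite (@ge0_integral_eq_off_null _ _ _ _ setT Z f (fun x => link_interior x A))//.
- rewrite (ge0_integral_hua_pickrell c'0 c'E)//; last 2 first.
  + exact: measurable_link_interior.
  + by move=> x; exact: link_interior_ge0.
  rewrite integral_link_interior_weight// (hua_pickrellE _ c0 cE).
  have K0 : N`!%:R * hp_const s N != 0.
    by rewrite mulf_neq0 ?pnatr_eq0 -?lt0n ?fact_gt0// gt_eqF// hp_const_gt0.
  (* The masses satisfy c' = N! K c with K = [hp_const s N], so the factor N! K divided by c' leaves
     1/c. *)
  have := hp_unnormalizedS hs N; rewrite cE c'E -EFinM => -[->].
  by rewrite [X in (X * _)%E]muleC -muleA -EFinM invfM mulVKf.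
- exact: hua_pickrell_null.
- exact: measurable_link_interior.
- move=> x _; rewrite /f /link; case: ifP => // _.
  case: ifP => _; first exact: link_interior_ge0.
  exact: measure_ge0.
- by move=> x _; exact: link_interior_ge0.
- move=> x _ /= /not_orP[x0 /contrapT wx].
  rewrite /f /link mem_set// mem_set//.
  by apply: vandermonde_neq0_interior => //; apply/eqP.
Qed.
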